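(* Let $h:[n]\to[n]$ be a Hessenberg function, let $G$ be the graph with vertex set $[n]$ and edge set $E=\{\{i,j\}\mid i,j\in[n],\ j<i\le h(j)\}$, let $X_G(\mathbf{x},t)$ be its chromatic quasisymmetric function, and let $\mathrm{Hess}(\mathsf{S},h)$ be the regular semisimple Hessenberg variety associated to $h$. Then, when $$\omega X_G(\mathbf{x},t)\qquad\text{and}\qquad \sum_{j=0}^{|E|}\mathrm{ch}\,H^{2j}(\mathrm{Hess}(\mathsf{S},h))\,t^j$$ are both expanded in the basis of Schur functions $s_\lambda(\mathbf{x})$, the coefficients (polynomials in $t$) of $s_n(\mathbf{x})$ in the two expressions are equal.
   Context: Cohomology is with $\mathbb{Q}$-coefficients; $[n]=\{1,\ldots,n\}$. A Hessenberg function is $h:[n]\to[n]$ with $h(i)\ge i$ for all $i$ and $h(i+1)\ge h(i)$ for $i<n$. (The graph $G$ is the incomparability graph of the poset $P(h)$ on $[n]$ with $j<_P i$ iff $h(j)<i$.) Chromatic quasisymmetric function: a coloring of $G$ is a map $\kappa:[n]\to\mathbb{P}$ to the positive integers with $\kappa(i)\ne\kappa(j)$ for every $\{i,j\}\in E$; $C(G)$ is the set of colorings, $\mathbf{x}_\kappa=\prod_{i\in[n]}x_{\kappa(i)}$ in countably many variables $x_1,x_2,\ldots$, and $\mathrm{asc}(\kappa)=|\{\{i,j\}\in E\mid j<i,\ \kappa(j)<\kappa(i)\}|$. Then $X_G(\mathbf{x},t)=\sum_{\kappa\in C(G)}t^{\mathrm{asc}(\kappa)}\mathbf{x}_\kappa$;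 for these graphs it is known that each coefficient of a power of $t$ is a symmetric function (Shareshian–Wachs). $\omega$ is the standard involution on symmetric functions exchanging elementary and complete homogeneous bases, so $\omega(s_\lambda)=s_{\lambda^*}$ with $\lambda^*$ the conjugate partition; it is applied coefficientwise in $t$. $s_n$ is the Schur function of the one-row partition $(n)$. $\mathsf{S}=\mathrm{diag}(\mu_1,\ldots,\mu_n)$ with distinct $\mu_i$, and $\mathrm{Hess}(\mathsf{S},h)$ is the variety of full flags $V_\bullet$ in $\mathbb{C}^n$ with $\mathsf{S}V_i\subset V_{h(i)}$ for all $i$. $\mathrm{ch}$ denotes the Frobenius characteristic of Tymoczko's $\mathfrak{S}_n$-representation on $H^{2j}(\mathrm{Hess}(\mathsf{S},h))$, defined as follows. The torus $T$ of invertible diagonal matrices acts on $\mathrm{Hess}(\mathsf{S},h)$ with fixed point set identified with $\mathfrak{S}_n$ ($w$ corresponds to the flag $V_i=\mathrm{span}\{e_{w(1)},\ldots,e_{w(i)}\}$). With $H_T^*(\mathrm{pt})=\mathbb{Q}[t_1,\ldots,t_n]$ ($t_i$ corresponding to the $i$-th coordinate character), restriction to fixed points identifies $H^*_T(\mathrm{Hess}(\mathsf{S},h))$ with the ring of tuples $\alpha=(\alpha(w))_{w\in\mathfrak{S}_n}$ of polynomials in $\mathbb{Q}[t_1,\ldots,t_n]$ such that $t_{w(i)}-t_{w(j)}$ divides $\alpha(w)-\alpha(w')$ whenever $w'=w(j\ i)$ with $1\le j<i\le h(j)$. The group $\mathfrak{S}_n$ acts by $(v\cdot\alpha)(w)=v\cdot\alpha(v^{-1}w)$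 with $v\cdot t_i=t_{v(i)}$, and this descends to $H^*(\mathrm{Hess}(\mathsf{S},h))\cong H^*_T(\mathrm{Hess}(\mathsf{S},h))/(t_1,\ldots,t_n)$, where $t_i$ denotes the constant tuple. *)

(* Defs.v *)
From HB Require Import structures.
From mathcomp Require Import all_boot all_order all_algebra all_fingroup.
From mathcomp Require Import ssrcomplements freeg mpoly.

Set Implicit Arguments.
Unset Strict Implicit.
Unset Printing Implicit Defensive.

Import GRing.Theory.
Local Open Scope ring_scope.

(* The vertex set [n] = {1, ..., n} is 'I_n = {0, ..., n-1}, and the colour set
   {1, 2, ...} is likewise shifted to nat; every condition below compares
   indices only with one another, so it is unchanged by the shift. *)

Definition Hessenberg n (h : 'I_n -> 'I_n) : Prop :=
  (forall i : 'I_n, (i <= h i)%N) /\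
  (forall i j : 'I_n, j = i.+1 :> nat -> (h i <= h j)%N).

Definition edges n (h : 'I_n -> 'I_n) : {set {set 'I_n}} :=
  [set [set p.1; p.2] | p : 'I_n * 'I_n & (p.2 < p.1 <= h p.2)%N].

(* A formal power series of bounded degree in x_1, x_2, ... is represented by
   its truncations f(x_1, ..., x_N, 0, 0, ...), one polynomial for each N; the
   variable x_{k+1} is 'X_k. Two series are equal iff all their truncations
   are: this is the description of symmetric functions as an inverse limit. *)
Definition bseries (R : comNzRingType) := forall N : nat, {mpoly R[N]}.

Section ChromaticQuasisymmetric.
Variables (n : nat) (E : {set {set 'I_n}}).

Definition proper N (k : {ffun 'I_n -> 'I_N}) : bool :=
  [forall i, forall j, ([set i; j] \in E) ==> (k i != k j)].

Definition asc N (k : {ffun 'I_n -> 'I_N}) : nat :=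
  #|[set e in E | [exists i : 'I_n, exists j : 'I_n,
      [&& e == [set i; j], (j < i)%N & (k j < k i)%N]]]|.

(* The coefficient ring is Q[t], whose variable t is 'X : {poly rat}. *)
Definition chromatic_qsym : bseries {poly rat} := fun N =>
  \sum_(k : {ffun 'I_n -> 'I_N} | proper k)
    'X^(asc k) *: \prod_(i < n) 'X_(k i).

End ChromaticQuasisymmetric.

(* Partitions of n, padded with zeros to exactly n parts. *)
Definition is_partition n (la : {ffun 'I_n -> 'I_n.+1}) : bool :=
  [forall i : 'I_n, forall j : 'I_n, (i <= j)%N ==> (la j <= la i)%N]
  && (\sum_(i < n) la i == n)%N.

Definition partition_of n := {la : {ffun 'I_n -> 'I_n.+1} | is_partition la}.

Definition part n (la : partition_of n) (i : 'I_n) : nat := val la i.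

Definition one_row_fun n : {ffun 'I_n -> 'I_n.+1} :=
  [ffun i : 'I_n => if i == 0%N :> nat then ord_max else ord0].

Lemma one_row_subproof n : is_partition (one_row_fun n).
Proof.
apply/andP; split.
  apply/forallP=> i; apply/forallP=> j; apply/implyP=> le_ij; rewrite !ffunE.
  by case: (nat_of_ord i) le_ij => [|i']; case: (nat_of_ord j).
case: n => [|n]; first by rewrite big_ord0.
rewrite big_ord_recl ffunE /= big1 ?addn0 //.
by move=> i _; rewrite ffunE.
Qed.

Definition one_row n : partition_of n :=
  exist (fun la => is_partition la) (one_row_fun n) (one_row_subproof n).

Section SymmetricFunctions.
Variable R : comNzRingType.

Definition complete (k : nat) : bseries R := fun N =>
  \sum_(m : 'X_{1..N < k.+1} | mdeg m == k) 'X_[m].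

Definition psum (k : nat) : bseries R := fun N => \sum_(i < N) 'X_i ^+ k.

(* Both families are 1 in degree 0, so the padding zeros are harmless. *)
Definition elementary_part n (la : partition_of n) : bseries R := fun N =>
  \prod_(i < n) mesym N R (part la i).

Definition complete_part n (la : partition_of n) : bseries R := fun N =>
  \prod_(i < n) complete (part la i) N.

Definition cell n (la : partition_of n) : finType :=
  {c : 'I_n * 'I_n | (c.2 < part la c.1)%N}.

Definition semistandard n (la : partition_of n) N
    (T : {ffun cell la -> 'I_N}) : bool :=
  [forall c : cell la, forall d : cell la,
     (((val c).1 == (val d).1) && ((val c).2 <= (val d).2)%N
        ==> (T c <= T d)%N)
  && (((val c).2 == (val d).2) && ((val c).1 < (val d).1)%N
        ==> (T c < T d)%N)].

Definition schur n (la : partition_of n) : bseries R := fun N =>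
  \sum_(T : {ffun cell la -> 'I_N} | semistandard T)
    \prod_(c : cell la) 'X_(T c).

Definition schur_expansion n (F : bseries R) (c : partition_of n -> R) : Prop :=
  forall N, F N = \sum_(la : partition_of n) c la *: schur la N.

(* The graph of omega in degree n: the R-linear map sending e_la to h_la. For
   R = Q[t] this is the coefficientwise extension of the involution over Q. *)
Definition is_omega n (F F' : bseries R) : Prop :=
  exists a : partition_of n -> R,
    (forall N, F N = \sum_(la : partition_of n) a la *: elementary_part la N) /\
    (forall N, F' N = \sum_(la : partition_of n) a la *: complete_part la N).

End SymmetricFunctions.

(* Frobenius characteristic of a class function chi on the symmetric group:
   (1/n!) \sum_w chi(w) p_(cycle type of w). *)
Definition Frobenius_ch n (chi : 'S_n -> rat) : bseries rat := fun N =>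
  (n`!%:R)^-1 *: \sum_(w : 'S_n)
     chi w *: \prod_(C in porbits w) psum rat #|C| N.

Section HessenbergCohomology.
Variables (n : nat) (h : 'I_n -> 'I_n).

Definition tuples := {ffun 'S_n -> {mpoly rat[n]}}.

(* The product of permutations is (s * u) x = u (s x), so [tperm j i * w] is
   the composite of w after the transposition (j i), that is, w(j i) in the
   usual notation, and [w * v^-1] is the usual v^-1 w. *)

(* The equivariant cohomology ring of Hess(S, h), as the image of restriction
   to the torus-fixed points. *)
Definition HT (alpha : tuples) : Prop :=
  forall (w : 'S_n) (i j : 'I_n), (j < i <= h j)%N ->
    exists q : {mpoly rat[n]},
      alpha w - alpha (tperm j i * w)%g = q * ('X_(w i) - 'X_(w j)).

(* Degree j in the t_i is cohomological degree 2j. *)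
Definition HT_deg (j : nat) (alpha : tuples) : Prop :=
  HT alpha /\ forall w, alpha w \is j.-homog.

(* The ideal of HT generated by the constant tuples t_i. *)
Definition HT_ideal (alpha : tuples) : Prop :=
  exists beta : 'I_n -> tuples,
    (forall i, HT (beta i)) /\
    alpha = \sum_(i < n) [ffun w => 'X_i * beta i w].

(* [msym v] is the ring morphism with t_i |-> t_(v i): see [msym_var]. *)
Definition dot_action (v : 'S_n) (alpha : tuples) : tuples :=
  [ffun w => msym v (alpha (w * v^-1)%g)].

(* The classes of b_1, ..., b_m form a basis of the degree-2j part of
   HT / (t_1, ..., t_n), which is H^{2j}(Hess(S, h)). *)
Definition H_basis (j m : nat) (b : 'I_m -> tuples) : Prop :=
  [/\ forall k, HT_deg j (b k),
      forall alpha, HT_deg j alpha ->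
        exists c : 'I_m -> rat, HT_ideal (alpha - \sum_(k < m) c k *: b k)
    & forall c : 'I_m -> rat, HT_ideal (\sum_(k < m) c k *: b k) ->
        forall k, c k = 0].

(* chi is the character of the representation on H^{2j}(Hess(S, h)): M v is the
   matrix of v in a basis of that space. *)
Definition H_character (j : nat) (chi : 'S_n -> rat) : Prop :=
  exists (m : nat) (b : 'I_m -> tuples) (M : 'S_n -> 'M[rat]_m),
    [/\ H_basis j b,
        forall v k, HT_ideal (dot_action v (b k) - \sum_(l < m) M v l k *: b l)
      & forall v, chi v = \tr (M v)].

End HessenbergCohomology.

Lemma msym_var n (v : 'S_n) (i : 'I_n) :
  msym v 'X_i = 'X_(v i) :> {mpoly rat[n]}.
Proof.
rewrite msymX; congr 'X_[_]; apply/mnmP=> k.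
by rewrite !mnmE; congr (nat_of_bool _); apply/eqP/eqP=> [->|<-];
   rewrite ?permKV ?permK.
Qed.

(* \sum_(j <= d) ch(chi_j) t^j *)
Definition graded_ch n (d : nat) (chi : nat -> 'S_n -> rat) :
    bseries {poly rat} := fun N =>
  \sum_(j < d.+1) 'X^j *: map_mpoly (@polyC rat) (Frobenius_ch (chi j) N).

(* Main.v *)
Require Import Defs.
From mathcomp Require Import all_boot all_order all_algebra all_fingroup.
From mathcomp Require Import mpoly.
From mathcomp Require Import zify ring.

Set Implicit Arguments.
Unset Strict Implicit.
Unset Printing Implicit Defensive.

Import Order.TTheory GRing.Theory Num.Theory.
Local Open Scope ring_scope.

(* Both coefficients equal P(t) = \prod_i [h(i) - i + 1]_t. In one variable every
   Schur function other than s_n vanishes, so the left coefficient is the sum of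
   the coefficients a_la in X_G = \sum_la a_la e_la, and the right one is the
   graded multiplicity of the trivial representation in H^*(Hess(S, h)).

   Left: the e_la specialized to N ones are polynomials in N with value (-1)^n at
   N = -1, which expresses \sum_la a_la as an alternating sum over surjective
   proper colorings, i.e. over ordered partitions into independent sets. The
   neighbours of the first vertex form a clique, so they lie in distinct blocks;
   inserting that vertex as a new block or into an old one cancels up to the
   factor -[h(1)]_t.

   Right: an invariant class is the tuple (w p)_w of a polynomial p. The polynomials
   r_k = \sum_(m <= k) x_m \prod_(k < l <= h(k)) (x_m - x_l) give classes in
   (t_1, ..., t_n), since the tuples equal to \prod_(k < l <= h(k)) (t_a - t_(w l))
   where w^-1(a) <= k and to 0 elsewhere satisfy the GKM conditions. Conversely the
   localization integral \sum_w w(p / e), e the product of the x_i - x_j over the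
   edges, kills (t_1, ..., t_n) and not e. Modulo the r_k everything is spanned by
   the products of factors x_k - x_l with h(k) - j_k < l <= h(k), and any linear form
   killing the r_k and the degrees below |E|, but not e, separates them. Both facts
   are proved by adding the edges at the first vertex s one at a time: with edges
   up to i, multiplication by x_s - x_i comes from the case i - 1, and modulo
   x_s - x_i the vertex s disappears. Merging x_s into x_i adds up the coefficients
   of their terms in the r_k, hence the positive weights c. *)

(** * Linear combinations of the elements of a list *)

Section LinearCombinations.
Variables (R : pzRingType) (V : lalgType R).
Implicit Types (l : seq V) (a : nat -> R).

(** Coefficients are sequences indexed by [nat], so that concatenating lists of different lengths
    changes no index type. *)
Definition lin l a : V := \sum_(j < size l) a j *: l`_j.

Lemma lin_cat l1 l2 a :
  lin (l1 ++ l2) a = lin l1 a + lin l2 (fun j => a (size l1 + j)%N).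
Proof.
rewrite /lin size_cat big_split_ord /=; congr (_ + _).
  by apply: eq_bigr => j _; rewrite nth_cat ltn_ord.
by apply: eq_bigr => j _; rewrite nth_cat ltnNge leq_addr /= addKn.
Qed.

Lemma lin_catE l1 l2 a1 a2 : exists a, lin (l1 ++ l2) a = lin l1 a1 + lin l2 a2.
Proof.
exists (fun j => if (j < size l1)%N then a1 j else a2 (j - size l1)%N).
rewrite lin_cat; congr (_ + _); apply: eq_bigr => j _ /=.
  by rewrite ltn_ord.
by rewrite ltnNge leq_addr /= addKn.
Qed.

End LinearCombinations.

Lemma lin_map (R : nzRingType) (V : algType R) (y : V) (l : seq V) a :
  lin [seq y * b | b <- l] a = y * lin l a.
Proof.
rewrite /lin size_map mulr_sumr; apply: eq_bigr => j _.
by rewrite (nth_map 0) // scalerAr.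
Qed.

(** * Quotients by the relations of a Hessenberg function *)

Section Relations.
Variables (n : nat) (H : nat -> nat).
Local Notation A := {mpoly rat[n]}.
Implicit Types (p q g : A) (c : nat -> rat) (I : nat -> A -> Prop).

(** The value is 0 for [k >= n]; products over intervals of natural numbers then carry no bound
    proofs. *)
Definition var k : A := \sum_(i < n | i == k :> nat) 'X_i.

Lemma var_ord (i : 'I_n) : var i = 'X_i.
Proof. by rewrite /var (big_pred1 i) // => j; rewrite -val_eqE. Qed.

Lemma var_homog k : var k \is 1.-homog.
Proof.
by apply: rpred_sum => i _; rewrite dhomogX /= mdeg1.
Qed.

Lemma varB_homog k l : var k - var l \is 1.-homog.
Proof. by rewrite rpredB ?var_homog. Qed.

(** The degree is a label: membership in [I d] does not force homogeneity. An ideal may thus have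
    the same members in every degree, as [annihilator L] and [inv_ideal] do. *)
Definition graded_ideal I : Prop :=
  [/\ forall d, I d 0,
      forall d p q, I d p -> I d q -> I d (p + q)
    & forall d e p q, q \is e.-homog -> I d p -> I (d + e)%N (q * p)].

Section GradedIdeal.
Variable I : nat -> A -> Prop.
Hypothesis idI : graded_ideal I.

Lemma gideal0 d : I d 0. Proof. by case: idI. Qed.

Lemma gidealD d p q : I d p -> I d q -> I d (p + q).
Proof. by case: idI => _ + _; apply. Qed.

Lemma gidealM d e p q : q \is e.-homog -> I d p -> I (d + e)%N (q * p).
Proof. by case: idI => _ _; apply. Qed.

Lemma gidealZ d a p : I d p -> I d (a *: p).
Proof.
move=> Ip; rewrite -mul_mpolyC -[d]addn0; apply: gidealM => //.
by rewrite -[a%:MP]mulr1 mul_mpolyC dhomogZ ?dhomog1.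
Qed.

Lemma gidealN d p : I d p -> I d (- p).
Proof. by rewrite -scaleN1r; apply: gidealZ. Qed.

Lemma gideal_sum d (J : Type) (r : seq J) (P : pred J) F :
  (forall j, P j -> I d (F j)) -> I d (\sum_(j <- r | P j) F j).
Proof.
by move=> IF; elim/big_rec: _ => [|j p /IF]; [apply: gideal0 | apply: gidealD].
Qed.

Lemma gidealMr d e f p q :
  q \is e.-homog -> I d p -> (d + e)%N = f -> I f (p * q).
Proof. by move=> hq Ip <-; rewrite mulrC; apply: gidealM. Qed.

Lemma gideal_vars d p :
  (forall k, (k < n)%N -> I 1 (var k)) -> p \is d.+1.-homog -> I d.+1 p.
Proof.
move=> Ivar hp; rewrite [p]mpolyE big_seq_cond; apply: gideal_sum => m.
rewrite andbT => mp; apply: gidealZ.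
have dm: mdeg m = d.+1 := dhomog_mf hp mp.
have [i mi] : exists i, m i != 0%N.
  apply/existsP; apply: contraT; rewrite negb_exists => /forallP m0.
  move: dm; rewrite mdegE big1 // => i _; apply/eqP.
  by move: (m0 i); rewrite negbK.
have lem : (U_(i) <= m)%MM.
  apply/mnm_lepP => j; rewrite mnm1E; case: eqP => //= <-; by rewrite lt0n.
rewrite -(submK lem) mpolyXD -[in X in I X _](add1n d).
rewrite -var_ord; apply: gidealM; last by apply: Ivar.
by rewrite dhomogX /=; move: dm; rewrite -{1}(submK lem) mdegD mdeg1 addn1 => -[->].
Qed.

End GradedIdeal.

(** With unit weights, [s = 0] and [i = H k], this is the polynomial r_k. *)
Definition hrel c s k i : A :=
  \sum_(s <= m < k.+1) c m *: (var m * \prod_(k.+1 <= l < i.+1) (var m - var l)).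

(** The state of the induction on edges: the vertices before [s] are eliminated, vertex [s] keeps
    its edges up to [s + r], and the later vertices keep all of theirs. By the last clause an
    eliminated variable is, modulo [I], either 0 or a surviving variable. *)
Definition relations c s r I : Prop :=
  [/\ graded_ideal I,
      (s < n)%N -> I r.+1 (hrel c s s (s + r)),
      forall k, (s < k < n)%N -> I (H k - k).+1 (hrel c s k (H k))
    & forall k, (k < s)%N ->
        I 1 (var k) \/ exists2 l, (s <= l < n)%N & I 1 (var k - var l)].

Hypothesis H_bounds : forall k, (k < n)%N -> (k <= H k < n)%N.
Hypothesis H_mono : forall k l, (k <= l < n)%N -> (H k <= H l)%N.

Lemma prodB_homog u a b :
  u \is 1.-homog -> \prod_(a <= l < b) (u - var l) \is (b - a).-homog.
Proof.
move=> hu; case: (leqP a b) => [le_ab|/ltnW le_ba]; last first.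
  by rewrite big_geq // (eqP le_ba) dhomog1.
rewrite -{1}(subnK le_ab); elim: (b - a)%N => [|d IHd].
  by rewrite big_geq ?dhomog1.
rewrite addSn big_nat_recr ?leq_addl //= -[d.+1]addn1.
by apply: dhomogM => //; rewrite rpredB ?var_homog.
Qed.

Lemma gideal_prodB_congr I u v a b : graded_ideal I ->
    u \is 1.-homog -> v \is 1.-homog -> I 1 (u - v) ->
  I (b - a)%N (\prod_(a <= l < b) (u - var l) - \prod_(a <= l < b) (v - var l)).
Proof.
move=> idI hu hv Iuv; case: (leqP a b) => [le_ab|/ltnW le_ba]; last first.
  by rewrite !big_geq // subrr; apply: gideal0.
rewrite -{2 3}(subnK le_ab); elim: (b - a)%N => [|d IHd].
  by rewrite !big_geq // subrr; apply: gideal0.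
rewrite addSn !big_nat_recr ?leq_addl //=.
set U := \prod_(_ <= _ < _) _; set V := \prod_(_ <= _ < _) _.
have -> : U * (u - var (d + a)) - V * (v - var (d + a))
        = (U - V) * (u - var (d + a)) + (u - v) * V by ring.
apply: gidealD => //.
  apply: gidealMr IHd (addn1 d) => //.
  by rewrite rpredB ?var_homog.
have := prodB_homog a (d + a) hv; rewrite addnK => hV.
exact: (gidealMr idI hV Iuv (add1n d)).
Qed.

Lemma rel_recl c s k i : (s <= k)%N ->
  hrel c s k i = c s *: (var s * \prod_(k.+1 <= l < i.+1) (var s - var l))
              + hrel c s.+1 k i.
Proof. by move=> le_sk; rewrite /hrel (@big_ltn _ _ _ s) ?ltnS. Qed.

Lemma rel_first c s i :
  hrel c s s i = c s *: (var s * \prod_(s.+1 <= l < i.+1) (var s - var l)).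
Proof. by rewrite /hrel big_nat1. Qed.

Lemma relations_var c s I :
  (s < n)%N -> 0 < c s -> relations c s 0 I -> I 1 (var s).
Proof.
move=> lt_sn c_gt0 [idI /(_ lt_sn) + _ _].
rewrite rel_first addn0 big_geq // mulr1 => /(gidealZ idI (c s)^-1).
by rewrite scalerA mulVf ?scale1r // gt_eqF.
Qed.

(** The common part of the two ways to eliminate vertex [s]: its variable becomes 0 or is identified
    with a later one, and the variables identified with it earlier follow. *)
Lemma relations_next c s I I' : graded_ideal I' ->
    (forall k, (s < k < n)%N -> I' (H k - k).+1 (hrel c s.+1 k (H k))) ->
    (forall d p, I d p -> I' d p) ->
    (forall k, (k < s)%N ->
        I 1 (var k) \/ exists2 l, (s <= l < n)%N & I 1 (var k - var l)) ->
    I' 1 (var s) \/ (exists2 l, (s < l < n)%N & I' 1 (var s - var l)) ->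
  relations c s.+1 (H s.+1 - s.+1) I'.
Proof.
move=> idI' rI' sII' redI redI'; split => //.
- move=> lt_sn; have /andP[le_sH _] := H_bounds lt_sn.
  by have := rI' s.+1; rewrite ltnS leqnn lt_sn subnKC //; apply.
- by move=> k /andP[lt_sk lt_kn]; apply: rI'; rewrite (ltnW lt_sk).
move=> k; rewrite ltnS leq_eqVlt => /orP[/eqP-> // | /redI[]].
  by move/sII'; left.
case=> l /andP[]; rewrite leq_eqVlt => /orP[/eqP<- | lt_sl] lt_ln /sII' Ikl.
  case: redI' => [Is | [l' ltl' Is]]; [left|right].
    by rewrite -[var k](subrK (var s)); apply: gidealD.
  exists l' => //; rewrite -[var k](subrK (var s)) -addrA.
  exact: gidealD.
by right; exists l; rewrite ?lt_sl.
Qed.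

Lemma relations_drop c s r I I' : (s < n)%N -> relations c s r I ->
    graded_ideal I' -> (forall d p, I d p -> I' d p) -> I' 1 (var s) ->
  relations c s.+1 (H s.+1 - s.+1) I'.
Proof.
move=> lt_sn [_ _ rI redI] idI' sII' Is.
apply: relations_next redI _ => //; last by left.
move=> k /[dup] /andP[lt_sk lt_kn] /rI /sII'; rewrite rel_recl 1?ltnW // => Ik.
set u := c s *: _ in Ik; rewrite -[hrel _ _ _ _](addKr u).
apply: gidealD => //; apply: gidealN => //; apply: gidealZ => //.
apply: (gidealMr idI' (prodB_homog _ _ (var_homog s)) Is _) => //.
Qed.

Definition merge_weight c s i : nat -> rat :=
  fun k => if k == i then c s + c k else c k.

(* Modulo [var s - var i] the term of [var s] either vanishes or doubles that of
   [var i]; this is what forces weights upon the relations. *)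
Lemma relations_merge c s r I I' : (s < n)%N -> (s + r.+1 <= H s)%N ->
    relations c s r.+1 I ->
    graded_ideal I' -> (forall d p, I d p -> I' d p) ->
    I' 1 (var s - var (s + r.+1)) ->
  relations (merge_weight c s (s + r.+1)) s.+1 (H s.+1 - s.+1) I'.
Proof.
move=> lt_sn; set i := (s + r.+1)%N => le_iH [_ _ rI redI] idI' sII' Isi.
have lt_si : (s < i)%N by rewrite /i addnS ltnS leq_addr.
have lt_in : (i < n)%N.
  by apply: leq_ltn_trans le_iH _; case/andP: (H_bounds lt_sn).
apply: relations_next redI _ => //; last by right; exists i; rewrite ?lt_si.
move=> k /[dup] /andP[lt_sk lt_kn] /rI /sII'; rewrite rel_recl 1?ltnW //.
set P := fun m => var m * \prod_(k.+1 <= l < (H k).+1) (var m - var l) => Ik.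
have le_kH : (k <= H k)%N by case/andP: (H_bounds lt_kn).
have hP m : \prod_(k.+1 <= l < (H k).+1) (var m - var l) \is (H k - k).-homog.
  by rewrite -subSS prodB_homog ?var_homog.
(* For [k < i], monotonicity gives [i <= H k], so the product of [var s] contains the factor
   [var s - var i]. For [k >= i], the terms of [var s] and [var i] agree modulo that factor. *)
case: (ltnP k i) => [lt_ki | le_ik].
  have -> : hrel (merge_weight c s i) s.+1 k (H k) = hrel c s.+1 k (H k).
    rewrite /hrel !big_nat; apply: eq_bigr => m /andP[_ lt_mk].
    by rewrite /merge_weight ltn_eqF // (leq_trans lt_mk).
  rewrite -[hrel _ _ _ _](addKr (c s *: P s)).
  apply: gidealD => //; apply: gidealN => //; apply: gidealZ => //.
  have le_iHk : (i <= H k)%N.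
    by apply: leq_trans le_iH (H_mono _); rewrite ltnW.
  rewrite /P (@big_cat_nat _ _ _ i) //=; last by rewrite ltnW // ltnS.
  rewrite (@big_ltn _ _ _ i) ?ltnS //.
  set X := \prod_(_ <= _ < _) _; set Y := \prod_(_ <= _ < _) _.
  rewrite [var s * _](_ : _ = (var s - var i) * (var s * (X * Y))); last by ring.
  have hXY : var s * (X * Y) \is (1 + ((i - k.+1) + ((H k).+1 - i.+1))).-homog.
    apply: dhomogM; first exact: var_homog.
    by apply: dhomogM; apply: prodB_homog; apply: var_homog.
  by apply: (gidealMr idI' hXY Isi _) => //; lia.
have -> : hrel (merge_weight c s i) s.+1 k (H k)
          = c s *: P i + hrel c s.+1 k (H k).
  have ri : i \in index_iota s.+1 k.+1 by rewrite mem_index_iota lt_si ltnS.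
  rewrite /hrel !(bigD1_seq _ ri (iota_uniq _ _)) /= addrA -scalerDl; congr (_ + _).
    by rewrite /merge_weight eqxx.
  by apply: eq_bigr => m /negPf ne_mi; rewrite /merge_weight ne_mi.
rewrite -[hrel c _ _ _](addKr (c s *: P s)) addrA -scalerBr -opprB scalerN.
apply: gidealD => //; apply: gidealN => //; apply: gidealZ => //.
rewrite /P; set U := \prod_(_ <= _ < _) _; set V := \prod_(_ <= _ < _) _.
have -> : var s * U - var i * V = (var s - var i) * U + (U - V) * var i by ring.
apply: gidealD => //.
  exact: (gidealMr idI' (hP s) Isi (add1n _)).
have := gideal_prodB_congr k.+1 (H k).+1 idI' (var_homog s) (var_homog i) Isi.
by rewrite subSS => IUV; apply: (gidealMr idI' (var_homog i) IUV (addn1 _)).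
Qed.

Lemma graded_ideal_colon I y :
  graded_ideal I -> graded_ideal (fun d p => I d.+1 (y * p)).
Proof.
move=> idI; split=> [d|d p q Ip Iq|d e p q hq Ip].
- by rewrite mulr0; apply: gideal0.
- by rewrite mulrDr; apply: gidealD.
by rewrite mulrCA -addSn; apply: gidealM.
Qed.

(** The relation at [s] with edges up to [s + r.+1] is [var s - var (s + r.+1)] times the one with
    edges up to [s + r], so the colon ideal loses exactly the last edge at [s]. *)
Lemma relations_colon c s r I : relations c s r.+1 I ->
  relations c s r (fun d p => I d.+1 ((var s - var (s + r.+1)) * p)).
Proof.
case=> idI rIs rI redI; set y := var s - _.
have hy : y \is 1.-homog := varB_homog s (s + r.+1).
have Iy d p : I d p -> I d.+1 (y * p) by rewrite -addn1; apply: gidealM.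
split; first exact: graded_ideal_colon.
- move=> /rIs; rewrite !rel_first addnS big_nat_recr ?ltnS ?leq_addr //= -addnS.
  by rewrite -scalerAr [y * _]mulrC mulrA.
- by move=> k /rI; apply: Iy.
move=> k /redI[Ik | [l ltl Ikl]]; first by left; apply: Iy.
by right; exists l => //; apply: Iy.
Qed.

Lemma relations_sub c s r I I' : graded_ideal I' ->
  (forall d p, I d p -> I' d p) -> relations c s r I -> relations c s r I'.
Proof.
move=> idI' sII' [_ rIs rI redI]; split=> // [/rIs | k /rI | k /redI[] ].
- exact: sII'.
- exact: sII'.
- by left; apply: sII'.
by case=> l ltl Ikl; right; exists l => //; apply: sII'.
Qed.

(** * The basis of products, its top element and its Hilbert series *)

Fixpoint ext s r (l : nat -> seq A) d : seq A :=
  if r is r'.+1 then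
    l d ++ (if d is e.+1 then
              [seq (var s - var (s + r)) * b | b <- ext s r' l e] else [::])
  else l d.

(* Unfolded, the elements are the products over s <= k < s + m of the
   [var k - var l] with H k - j_k < l <= H k, where j_k <= H k - k and the
   j_k sum to d. *)
Fixpoint bas s m d : seq A :=
  if m is m'.+1 then ext s (H s - s) (bas s.+1 m') d
  else if d == 0%N then [:: 1] else [::].

Definition exttop s r : A := \prod_(s.+1 <= l < (s + r).+1) (var s - var l).

Lemma exttop0 s : exttop s 0 = 1.
Proof. by rewrite /exttop addn0 big_geq. Qed.

Lemma exttopS s r : exttop s r.+1 = exttop s r * (var s - var (s + r.+1)).
Proof. by rewrite /exttop addnS big_nat_recr ?ltnS ?leq_addr. Qed.

Lemma exttop_homog s r : exttop s r \is r.-homog.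
Proof.
by have := prodB_homog s.+1 (s + r).+1 (var_homog s); rewrite subSS addKn.
Qed.

Fixpoint bastop s m : A :=
  if m is m'.+1 then exttop s (H s - s) * bastop s.+1 m' else 1.

Fixpoint basdeg s m : nat :=
  if m is m'.+1 then (H s - s + basdeg s.+1 m')%N else 0%N.

Lemma ext_top s r l e E : l E = [:: e] -> (forall d, (E < d)%N -> l d = [::]) ->
  ext s r l (r + E) = [:: exttop s r * e] /\
  forall d, (r + E < d)%N -> ext s r l d = [::].
Proof.
move=> lE lgtE; elim: r => [|r [IH1 IH2]] /=; first by rewrite exttop0 mul1r.
split.
  by rewrite lgtE ?addSn ?ltnS ?leq_addl // IH1 /= exttopS mulrAC mulrC.
case=> // d; rewrite addSn ltnS => lt_d; rewrite IH2 // lgtE //.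
by move: lt_d; lia.
Qed.

Lemma bas_top s m : bas s m (basdeg s m) = [:: bastop s m] /\
  forall d, (basdeg s m < d)%N -> bas s m d = [::].
Proof.
elim: m s => [|m IHm] s /=; first by split=> // -[].
by case: (IHm s.+1) => IH1 IH2; apply: ext_top.
Qed.

Lemma bas_homog s m d b : b \in bas s m d -> b \is d.-homog.
Proof.
elim: m s d b => [|m IHm] s d b /=.
  by case: d => [|d] //=; rewrite inE => /eqP->; apply: dhomog1.
elim: (H s - s)%N d b => [|r IHr] d b /=; first exact: IHm.
rewrite mem_cat => /orP[/IHm // |]; case: d => // d /mapP[b' /IHr hb' ->].
exact: (dhomogM (varB_homog s (s + r.+1)) hb').
Qed.

Definition tint k : {poly rat} := \sum_(j < k) 'X^j.

(** The two halves of the list in [ext] match the recursion [r+2]_t = 1 + t [r+1]_t. *)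
Lemma size_bas s m d :
  (size (bas s m d))%:R = (\prod_(s <= k < s + m) tint (H k - k).+1)`_d.
Proof.
elim: m s d => [|m IHm] s d.
  by rewrite addn0 big_geq // coef1 /=; case: eqP.
rewrite addnS big_ltn ?ltnS ?leq_addr // -addSn /=.
set g := \prod_(_ <= _ < _) _.
elim: (H s - s)%N d => [|r IHr] d /=.
  by rewrite IHm /tint big_ord_recl big_ord0 expr0 addr0 mul1r.
rewrite size_cat natrD IHm.
have -> : tint r.+2 = 1 + 'X * tint r.+1.
  rewrite /tint [LHS]big_ord_recl expr0 mulr_sumr; congr (_ + _).
  by apply: eq_bigr => j _; rewrite -exprS.
rewrite mulrDl mul1r coefD -mulrA coefXM; congr (_ + _).
by case: d => [|d] //=; rewrite size_map IHr.
Qed.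

(** Induction on the remaining vertices, then on the edges at [s]. Modulo the factor [y] of the last
    edge, vertex [s] merges into a later one, which yields the elements without the factor [y]. What
    remains is a multiple of [y], whose cofactor is expanded modulo the colon ideal. *)
Lemma basis_spans m s c I d p : (s + m)%N = n ->
    (forall k, (s <= k)%N -> 0 < c k) -> relations c s (H s - s) I ->
  p \is d.-homog -> exists a, I d (p - lin (bas s m d) a).
Proof.
elim: m s c I d p => [|m IHm] s c I d p.
  rewrite addn0 => sn _ [idI _ _ redI] hp; case: d hp => [|d] hp.
    exists (fun _ => p@_0); rewrite /lin big_ord_recl big_ord0 addr0 /=.
    suff -> : p = p@_0 *: 1 by rewrite mcoeffZ mcoeff1 eqxx mulr1 subrr; apply: gideal0.
    apply/mpolyP => k; rewrite mcoeffZ mcoeff1.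
    have [-> | k0] := eqVneq k 0%MM; first by rewrite mulr1.
    by rewrite mulr0; apply: dhomog_nemf_coeff hp _; rewrite mdeg_eq0.
  exists (fun _ => 0); rewrite /lin big_ord0 subr0.
  (* No surviving variable is left, so every variable lies in [I]. *)
  apply: gideal_vars => // k lt_kn; case: (redI k); rewrite ?sn // => -[l].
  by case/andP=> le_nl; rewrite ltnNge le_nl.
move=> smn c_gt0; have lt_sn : (s < n)%N by rewrite -smn addnS ltnS leq_addr.
move: smn; rewrite addnS -addSn => smn /=.
have := leqnn (H s - s); move: {1 3 4}(H s - s)%N => r.
elim: r I d p => [|r IHr] I d p le_r relI hp; case: (relI) => idI _ _ _.
  apply: (IHm _ c) hp => // [k lt_sk|]; first by apply: c_gt0; apply: ltnW.
  apply: (relations_drop lt_sn relI idI) => //.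
  exact: (relations_var lt_sn (c_gt0 _ (leqnn _)) relI).
set y := var s - var (s + r.+1).
(* This is the ideal generated by [I] and [y]. The cofactor [t] is kept homogeneous because the
   inner induction hypothesis will be applied to it. *)
pose I' e q := exists i t, [/\ I e i, q = i + y * t
  & if e is e'.+1 then t \is e'.-homog else t = 0].
have hy : y \is 1.-homog := varB_homog s (s + r.+1).
have idI' : graded_ideal I'.
  split=> [e | e q q' | e f q q' hq'].
  - exists 0, 0; split; [exact: gideal0 | by rewrite mulr0 addr0 |].
    by case: e => // e; apply: dhomog0.
  - case=> [i [t [Ii -> ht]]] [i' [t' [Ii' -> ht']]].
    exists (i + i'), (t + t'); split; [exact: gidealD | by ring |].
    case: e {Ii Ii'} ht ht' => [|e] => [-> -> | ht ht'].
      by rewrite addr0.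
    by rewrite rpredD.
  case=> [i [t [Ii -> ht]]]; exists (q' * i), (q' * t).
  split; [exact: gidealM | by ring |].
  case: e {Ii} ht => [|e] ht; last by rewrite addSn addnC; apply: dhomogM.
  by rewrite ht mulr0; case: (0 + f)%N => // g; apply: dhomog0.
have sII' e q : I e q -> I' e q.
  move=> Iq; exists q, 0; split=> //; first by rewrite mulr0 addr0.
  by case: e {Iq} => // e; apply: dhomog0.
have I'y : I' 1 y.
  exists 0, 1; split; [exact: gideal0 | by rewrite mulr1 add0r | exact: dhomog1].
have le_rH : (s + r.+1 <= H s)%N by move: le_r; lia.
have relI' := relations_merge lt_sn le_rH relI idI' sII' I'y.
have [|a [i [t [Ii Dp ht]]]] := IHm _ _ _ _ _ smn _ relI' hp.
  move=> k lt_sk; rewrite /merge_weight; case: ifP => _; last exact/c_gt0/ltnW.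
  by rewrite addr_gt0 ?c_gt0 // ltnW.
case: d hp Ii Dp ht => [|d] hp Ii Dp ht /=.
  by exists a; rewrite cats0 Dp ht mulr0 addr0.
have [a' Ia'] := IHr _ _ _ (ltnW le_r) (relations_colon relI) ht.
have [b Db] := lin_catE (bas s.+1 m d.+1)
  [seq y * x | x <- ext s r (bas s.+1 m) d] a a'.
exists b; rewrite -/y Db lin_map opprD addrA Dp -addrA -mulrBr.
exact: gidealD.
Qed.

(** * Linear forms and linear independence *)

Definition linear_form (L : A -> rat) : Prop :=
  forall a p q, L (a *: p + q) = a * L p + L q.

(** For linear [L], the largest ideal inside its kernel, with the same members in every degree. *)
Definition annihilator (L : A -> rat) (d : nat) p : Prop := forall g, L (p * g) = 0.

Section LinearForm.
Variable L : A -> rat.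
Hypothesis linL : linear_form L.

Lemma lform0 : L 0 = 0.
Proof. by have := linL (-1) 0 0; rewrite scaler0 addr0 mulN1r addNr. Qed.

Lemma lformD p q : L (p + q) = L p + L q.
Proof. by have := linL 1 p q; rewrite scale1r mul1r. Qed.

Lemma lformZ a p : L (a *: p) = a * L p.
Proof. by have := linL a p 0; rewrite !addr0 lform0 addr0. Qed.

Lemma lformB p q : L (p - q) = L p - L q.
Proof. by rewrite lformD -scaleN1r lformZ mulN1r. Qed.

Lemma lform_sum J (r : seq J) (P : pred J) F :
  L (\sum_(j <- r | P j) F j) = \sum_(j <- r | P j) L (F j).
Proof. exact: (big_morph _ lformD lform0). Qed.

Lemma lform_lin l a : (forall b, b \in l -> L b = 0) -> L (lin l a) = 0.
Proof.
move=> Ll; rewrite lform_sum big1 // => j _.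
by rewrite lformZ Ll ?mulr0 // mem_nth.
Qed.

Lemma lform_homog : (forall d p, p \is d.-homog -> L p = 0) -> forall p, L p = 0.
Proof.
move=> Lh p; rewrite [p]mpolyE lform_sum big1 // => m _.
by rewrite (Lh (mdeg m)) // dhomogZ // dhomogX /=.
Qed.

Lemma linear_form_mul y : linear_form (fun p => L (y * p)).
Proof. by move=> a p q; rewrite mulrDr -scalerAr linL. Qed.

Lemma annihilator_ideal : graded_ideal (annihilator L).
Proof.
split=> [d g | d p q Lp Lq g | d e p q _ Lp g].
- by rewrite mul0r lform0.
- by rewrite mulrDl lformD Lp Lq addr0.
by rewrite -mulrA mulrCA Lp.
Qed.

Lemma annihilator_mul y d p : annihilator L d p -> annihilator (fun q => L (y * q)) d p.
Proof. by move=> Lp g; rewrite mulrCA Lp. Qed.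

Lemma lform_basis_eq0 s m c : (s + m)%N = n ->
    (forall k, (s <= k)%N -> 0 < c k) ->
    relations c s (H s - s) (annihilator L) ->
  (forall d b, b \in bas s m d -> L b = 0) -> forall p, L p = 0.
Proof.
move=> smn c_gt0 relL Lb; apply: lform_homog => d p hp.
have [a /(_ 1)] := basis_spans smn c_gt0 relL hp.
by rewrite mulr1 lformB (lform_lin _ (@Lb d)) subr0.
Qed.

End LinearForm.

(** The induction of [basis_spans], dualized. Let [y] be the factor of the last edge and
    [x = var s * exttop s r]. The relation at [s] makes [x * y] annihilate [L], so the form
    [L (x * _)] satisfies the merged relations and detects the elements without the factor [y]; the
    form [L (y * _)] satisfies the colon relations and detects the others. *)
Lemma basis_independent s m c L : (s + m)%N = n ->
    (forall k, (s <= k)%N -> 0 < c k) -> linear_form L ->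
    relations c s (H s - s) (annihilator L) ->
    (forall d p, (d < basdeg s m)%N -> p \is d.-homog -> L p = 0) ->
    L (bastop s m) != 0 ->
  forall d a, annihilator L d (lin (bas s m d) a) ->
  forall k, (k < size (bas s m d))%N -> a k = 0.
Proof.
elim: m s c L => [|m IHm] s c L.
  move=> _ _ linL _ _ L1 [|d] a //= /(_ 1); rewrite mulr1 /lin big_ord_recl big_ord0.
  rewrite addr0 /= (lformZ linL) => /eqP; rewrite mulf_eq0 (negPf L1) orbF.
  by move/eqP=> a0 [|k].
move=> smn c_gt0; have lt_sn : (s < n)%N by rewrite -smn addnS ltnS leq_addr.
move: smn; rewrite addnS -addSn => smn /=.
have c_gt0' k : (s < k)%N -> 0 < c k by move/ltnW/c_gt0.
have := leqnn (H s - s); move: {1 3 4 5 6 7}(H s - s)%N => r.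
elim: r L => [|r IHr] L le_r linL relL Lsmall Ltop.
  rewrite exttop0 mul1r in Ltop; apply: (IHm _ c) smn c_gt0' (linL) _ Lsmall Ltop.
    apply: (relations_drop lt_sn relL (annihilator_ideal linL)) => //.
    exact: (relations_var lt_sn (c_gt0 _ (leqnn _)) relL).
set e' := basdeg s.+1 m in Lsmall; set y := var s - var (s + r.+1).
have hy : y \is 1.-homog := varB_homog s (s + r.+1).
set P := exttop s r; have hP : P \is r.-homog := exttop_homog s r.
pose x := var s * P.
have hx : x \is r.+1.-homog by rewrite -add1n; apply: dhomogM (var_homog _) hP.
have [bas_e' bas_gt] := bas_top s.+1 m.
have le_rH : (s + r.+1 <= H s)%N by move: le_r; lia.
have linLx := linear_form_mul linL x.
have Lxy g : L (x * y * g) = 0.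
  case: (relL) => _ /(_ lt_sn) + _ _; rewrite rel_first => /(_ g).
  rewrite -[\prod_(_ <= _ < _) _]/(exttop s r.+1) exttopS mulrA -scalerAl.
  rewrite (lformZ linL) => /eqP; rewrite mulf_eq0 gt_eqF ?c_gt0 //.
  by move/eqP.
have relLx : relations (merge_weight c s (s + r.+1)) s.+1 (H s.+1 - s.+1)
                       (annihilator (fun p => L (x * p))).
  apply: relations_merge relL (annihilator_ideal linLx) _ _ => // [d p|].
    exact: annihilator_mul.
  by move=> g; rewrite mulrA Lxy.
have c'_gt0 k : (s < k)%N -> 0 < merge_weight c s (s + r.+1) k.
  move=> lt_sk; rewrite /merge_weight; case: ifP => _; last exact: c_gt0'.
  by apply: addr_gt0; [apply: c_gt0 | apply: c_gt0'].
have Lxsmall d p : (d < e')%N -> p \is d.-homog -> L (x * p) = 0.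
  move=> lt_d hp; apply: (Lsmall (r.+1 + d)%N); first by rewrite ltn_add2l.
  exact: dhomogM.
(* Otherwise [L (x * _)] vanishes on the basis, hence everywhere. Then [var s] annihilates
   [L (P * _)], which vanishes too, since on basis elements it takes values of [L] below the top
   degree. This contradicts [Ltop]. *)
have Lxtop : L (x * bastop s.+1 m) != 0.
  apply: contraNneq Ltop => Lx0.
  have Lx g : L (x * g) = 0.
    move: g; apply: (lform_basis_eq0 linLx smn c'_gt0 relLx) => d b.
    case: (ltngtP d e') => [lt_d | gt_d | ->].
    - by move/bas_homog; apply: Lxsmall.
    - by rewrite bas_gt.
    by rewrite bas_e' inE => /eqP->.
  have linLP := linear_form_mul linL P.
  have relLP : relations c s.+1 (H s.+1 - s.+1) (annihilator (fun p => L (P * p))).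
    apply: relations_drop relL (annihilator_ideal linLP) _ _ => // [d p|g].
      exact: annihilator_mul.
    by rewrite mulrA [P * _]mulrC Lx.
  have LP := lform_basis_eq0 linLP smn c_gt0' relLP.
  rewrite exttopS -mulrA LP // => d b hb.
  case: (leqP d e') => [le_d | gt_d]; last by rewrite bas_gt in hb.
  apply: (Lsmall (r + d)%N); first by rewrite addSn ltnS leq_add2l.
  by apply: dhomogM => //; apply: bas_homog hb.
have indep_x := IHm _ _ _ smn c'_gt0 linLx relLx Lxsmall Lxtop.
move=> d a; rewrite lin_cat; set l2 := if d is _.+1 then _ else _.
set a2 := fun j => _; move=> Ll.
have linLy := linear_form_mul linL y.
have relLy : relations c s r (annihilator (fun p => L (y * p))).
  apply: relations_sub (annihilator_ideal linLy) _ (relations_colon relL) => e p Lyp g.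
  by rewrite mulrA Lyp.
have indep2 b : annihilator L d (lin l2 b) ->
    forall k, (k < size l2)%N -> b k = 0.
  rewrite /l2; case: (d) => [|e] // Lb k; rewrite size_map.
  apply: (IHr _ (ltnW le_r) linLy relLy) => [f p lt_f hp| |g].
  - apply: (Lsmall (1 + f)%N); first by rewrite addSn ltnS.
    exact: dhomogM.
  - by rewrite mulrA [y * _]mulrC -exttopS.
  by rewrite mulrA -lin_map Lb.
have lin2 b :
    lin l2 b = y * (if d is e.+1 then lin (ext s r (bas s.+1 m) e) b else 0).
  rewrite /l2; case: (d) => [|e]; last exact: lin_map.
  by rewrite mulr0 /lin big_ord0.
have a1 k : (k < size (bas s.+1 m d))%N -> a k = 0.
  apply: (indep_x d) => g; move: (Ll (x * g)); rewrite lin2.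
  set u := lin _ _; set z := (X in y * X) => Luz.
  have -> : x * (u * g) = (u + y * z) * (x * g) - x * y * (z * g) by ring.
  by rewrite (lformB linL) Luz Lxy subrr.
have lin1 : lin (bas s.+1 m d) a = 0.
  by rewrite /lin big1 // => j _; rewrite a1 ?scale0r.
rewrite lin1 add0r in Ll; move=> k; rewrite size_cat.
case: (ltnP k (size (bas s.+1 m d))) => [/a1 // | le_k lt_k].
rewrite -(subnKC le_k) -[a _]/(a2 _); apply: indep2 => //.
by rewrite ltn_subLR.
Qed.

End Relations.

(** * Divisibility by differences of variables *)

Section PolynomialDivisibility.
Variable n : nat.
Local Notation A := {mpoly rat[n]}.
Implicit Types (p q g : A).

Lemma mpoly_ring_ind (P : A -> Prop) :
    (forall a, P a%:MP) -> (forall i, P 'X_i) ->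
    (forall p q, P p -> P q -> P (p + q)) ->
    (forall p q, P p -> P q -> P (p * q)) -> forall p, P p.
Proof.
move=> PC PX PD PM p; rewrite [p]mpolyE; elim/big_rec: _ => [|m q _ Pq].
  by rewrite -mpolyC0.
apply: PD (Pq); rewrite -mul_mpolyC; apply: (PM) (PC _) _.
rewrite mpolyXE_id; elim/big_rec: _ => [|i q' _ Pq']; first by rewrite -mpolyC1.
apply: (PM) (Pq'); elim: (m i) => [|k IHk]; first by rewrite expr0 -mpolyC1.
by rewrite exprS; apply: PM.
Qed.

Definition mdvd (a p : A) : Prop := exists q, p = q * a.

Lemma mdvd0 a : mdvd a 0. Proof. by exists 0; rewrite mul0r. Qed.

Lemma mdvdD a p q : mdvd a p -> mdvd a q -> mdvd a (p + q).
Proof. by case=> u -> [v ->]; exists (u + v); rewrite mulrDl. Qed.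

Lemma mdvdMl a p q : mdvd a p -> mdvd a (q * p).
Proof. by case=> u ->; exists (q * u); rewrite mulrA. Qed.

Lemma mdvdMr a p q : mdvd a p -> mdvd a (p * q).
Proof. by rewrite mulrC; apply: mdvdMl. Qed.

Lemma mdvdZ a k p : mdvd a p -> mdvd a (k *: p).
Proof. by rewrite -mul_mpolyC; apply: mdvdMl. Qed.

Lemma mdvdN a p : mdvd a p -> mdvd a (- p).
Proof. by rewrite -scaleN1r; apply: mdvdZ. Qed.

Lemma mdvdB a p q : mdvd a p -> mdvd a q -> mdvd a (p - q).
Proof. by move=> ? /mdvdN; apply: mdvdD. Qed.

Lemma mdvd_sum a (J : Type) (r : seq J) (P : pred J) F :
  (forall j, P j -> mdvd a (F j)) -> mdvd a (\sum_(j <- r | P j) F j).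
Proof. by move=> aF; elim/big_rec: _ => [|j p /aF]; [apply: mdvd0 | apply: mdvdD]. Qed.

Lemma mdvd_refl a : mdvd a a. Proof. by exists 1; rewrite mul1r. Qed.

Lemma mdvdBC (i j : 'I_n) p : mdvd ('X_i - 'X_j) p -> mdvd ('X_j - 'X_i) p.
Proof. by case=> q ->; exists (- q); rewrite mulNr -mulrN opprB. Qed.

Lemma mdvd_morph (a : A) (f : A -> A) :
    (forall k : rat, f k%:MP = k%:MP) ->
    {morph f : p q / p + q} -> {morph f : p q / p * q} ->
    (forall i, mdvd a ('X_i - f 'X_i)) -> forall p, mdvd a (p - f p).
Proof.
move=> fC fD fM fX; apply: mpoly_ring_ind => [k | // | p q ap aq | p q ap aq].
- by rewrite fC subrr; apply: mdvd0.
- by rewrite fD opprD addrACA; apply: mdvdD.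
have -> : p * q - f (p * q) = (p - f p) * q + f p * (q - f q).
  by rewrite fM; ring.
by apply: mdvdD; [apply: mdvdMr | apply: mdvdMl].
Qed.

Lemma msymC (w : 'S_n) (k : rat) : msym w k%:MP = k%:MP :> A.
Proof. by rewrite -[k%:MP]mulr1 mul_mpolyC msymZ msym1. Qed.

Lemma msym_tperm_congr (i j : 'I_n) p :
  mdvd ('X_i - 'X_j) (p - msym (tperm i j) p).
Proof.
move: p; apply: mdvd_morph => [k|||k]; [exact: msymC | exact: msymD | exact: msymM |].
rewrite msym_var; case: tpermP => [->|->|_ _]; last by rewrite subrr; apply: mdvd0.
  exact: mdvd_refl.
exact/mdvdBC/mdvd_refl.
Qed.

Definition merge_var (i j : 'I_n) p : A :=
  p \mPo [tuple 'X_(if k == i then j else k) | k < n].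

Lemma merge_varX i j k : merge_var i j 'X_k = 'X_(if k == i then j else k).
Proof. by rewrite /merge_var comp_mpolyXU -tnth_nth tnth_mktuple. Qed.

Lemma merge_var_congr i j p : mdvd ('X_i - 'X_j) (p - merge_var i j p).
Proof.
move: p; apply: mdvd_morph => [k|p q|p q|k].
- exact: comp_mpolyC.
- exact: comp_mpolyD.
- exact: rmorphM.
rewrite merge_varX; case: eqP => [->|_]; first exact: mdvd_refl.
by rewrite subrr; apply: mdvd0.
Qed.

Lemma mpolyXU_inj (i j : 'I_n) : ('X_i : A) = 'X_j -> i = j.
Proof.
move/(congr1 (meval (fun k => (k == i)%:R))); rewrite !mevalXU eqxx.
by case: eqP => // _ /eqP; rewrite oner_eq0.
Qed.

(** Substituting x_j for x_i kills [p] but none of the other factors, hence kills the quotient of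
    [p] by these; so x_i - x_j divides that quotient. Ordering the pairs excludes the proportional
    factor x_j - x_i. *)
Lemma mdvd_coprime (s : seq ('I_n * 'I_n)) p : uniq s ->
    all (fun e : 'I_n * 'I_n => (e.1 < e.2)%N) s ->
    (forall e, e \in s -> mdvd ('X_e.1 - 'X_e.2) p) ->
  mdvd (\prod_(e <- s) ('X_e.1 - 'X_e.2)) p.
Proof.
elim: s p => [|[i j] s IHs] p /=.
  by rewrite big_nil; exists p; rewrite mulr1.
case/andP=> ijs us /andP[lt_ij ls] ep; rewrite big_cons /=.
have [q Dp] : mdvd (\prod_(e <- s) ('X_e.1 - 'X_e.2)) p.
  by apply: IHs => // e es; apply: ep; rewrite inE es orbT.
have [p' Dp'] := ep _ (mem_head _ _).
pose f := merge_var i j.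
have fM u v : f (u * v) = f u * f v by apply: rmorphM.
have fB u v : f (u - v) = f u - f v by apply: comp_mpolyB.
have: f q * f (\prod_(e <- s) ('X_e.1 - 'X_e.2)) = 0.
  by rewrite -fM -Dp Dp' fM fB /f !merge_varX eqxx if_same subrr mulr0.
move/eqP; rewrite mulf_eq0 => /orP[/eqP fq0 | ].
  have [t Dq] := merge_var_congr i j q; exists t.
  by rewrite Dp -[q]subr0 -fq0 Dq mulrA.
rewrite [f _]rmorph_prod /= prodf_seq_eq0 => /hasP[[k l] kls /=].
rewrite [_ == 0](_ : _ = (f ('X_k - 'X_l) == 0)) // fB subr_eq0 /f !merge_varX.
move/eqP/mpolyXU_inj.
have lt_kl : (k < l)%N by apply: (allP ls) kls.
case: eqP => [ki | ki]; case: eqP => [li | li].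
- by move: lt_kl; rewrite ki li ltnn.
- by move=> jl; move: ijs; rewrite -ki jl kls.
- by move=> kj; move: lt_kl; rewrite kj li ltnNge (ltnW lt_ij).
by move=> kl; move: lt_kl; rewrite kl ltnn.
Qed.

Lemma dhomog_bigprod (J : Type) (r : seq J) (P : pred J) (F : J -> A) (d : J -> nat) :
  (forall j, P j -> F j \is (d j).-homog) ->
  \prod_(j <- r | P j) F j \is (\sum_(j <- r | P j) d j).-homog.
Proof.
move=> hF; elim/big_rec2: _ => [|j p e Pj hp]; first exact: dhomog1.
exact: dhomogM (hF j Pj) hp.
Qed.

Lemma msym_homog (w : 'S_n) d p : p \is d.-homog -> msym w p \is d.-homog.
Proof. by rewrite !homog_piE -msym_pihomog => /eqP->. Qed.

Lemma mpolyXB_homog (i j : 'I_n) : 'X_i - 'X_j \is [in rat[n], 1.-homog].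
Proof. by rewrite rpredB // dhomogX /= mdeg1. Qed.

(** * The Vandermonde product *)

Definition vandermonde : A := \prod_(i < n) \prod_(j < n | (i < j)%N) ('X_i - 'X_j).

Lemma vandermonde_pairs :
  vandermonde
  = \prod_(e <- [seq e : 'I_n * 'I_n <- index_enum ('I_n * 'I_n)%type
                 | (e.1 < e.2)%N]) ('X_e.1 - 'X_e.2).
Proof. by rewrite /vandermonde pair_big_dep big_filter. Qed.

Lemma vandermonde_neq0 : vandermonde != 0.
Proof.
apply/prodf_neq0 => i _; apply/prodf_neq0 => j lt_ij.
by rewrite subr_eq0; apply: contraTneq lt_ij => /mpolyXU_inj ->; rewrite ltnn.
Qed.

Lemma vandermonde_homog : exists D, vandermonde \is D.-homog.
Proof.
exists (\sum_(i < n) \sum_(j < n | (i < j)%N) 1)%N.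
apply: dhomog_bigprod => i _; apply: dhomog_bigprod => j _.
exact: mpolyXB_homog.
Qed.

Lemma msym_vandermonde (w : 'S_n) : msym w vandermonde = (-1) ^+ w *: vandermonde.
Proof.
(* The factors in [det_Vandermonde] are v_j - v_i, whence the minus sign. *)
pose v : 'rV[A]_n := \row_j - 'X_j.
have DV : vandermonde = \det (Vandermonde n v).
  rewrite det_Vandermonde; apply: eq_bigr => i _; apply: eq_bigr => j _.
  by rewrite !mxE opprK addrC.
rewrite {1}DV -det_map_mx.
have -> : map_mx (msym w) (Vandermonde n v) = col_perm w (Vandermonde n v).
  by apply/matrixP => i j; rewrite !mxE rmorphXn /= rmorphN /= msym_var.
rewrite col_permE det_mulmx det_perm -DV odd_permV mulrC.
by rewrite -mul_mpolyC rmorphXn rmorphN rmorph1.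
Qed.

End PolynomialDivisibility.

(** * Invariant classes *)

Section InvariantTuples.
Variables (n : nat) (h : 'I_n -> 'I_n).
Hypothesis hess_h : Hessenberg h.
Local Notation A := {mpoly rat[n]}.
Local Notation tuples := (tuples n).
Implicit Types (p q g : A) (al be ga : tuples).

Lemma le_hess (i : 'I_n) : (i <= h i)%N. Proof. by case: hess_h. Qed.

Definition hess_nat k : nat := \sum_(i < n | i == k :> nat) h i.

Lemma hess_natE (i : 'I_n) : hess_nat i = h i.
Proof. by rewrite /hess_nat (big_pred1 i) // => j; rewrite -val_eqE. Qed.

Lemma hess_nat_bounds k : (k < n)%N -> (k <= hess_nat k < n)%N.
Proof.
move=> lt_kn; rewrite (hess_natE (Ordinal lt_kn)).
by rewrite (le_hess (Ordinal lt_kn)) ltn_ord.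
Qed.

Lemma hess_nat_mono k l : (k <= l < n)%N -> (hess_nat k <= hess_nat l)%N.
Proof.
case: hess_h => _ hS /andP[le_kl lt_ln].
elim: l le_kl lt_ln => [|l IHl]; first by rewrite leqn0 => /eqP->.
rewrite leq_eqVlt ltnS => /orP[/eqP-> // | le_kl lt_ln].
apply: leq_trans (IHl le_kl (ltnW lt_ln)) _.
rewrite (hess_natE (Ordinal (ltnW lt_ln))) (hess_natE (Ordinal lt_ln)).
exact: hS.
Qed.

Definition inv_tuple p : tuples := [ffun w => msym w p].

Definition mul_tuple al be : tuples := [ffun w => al w * be w].

Lemma HT0 : HT h 0.
Proof. by move=> w i j _; exists 0; rewrite !ffunE subrr mul0r. Qed.

Lemma HTD al be : HT h al -> HT h be -> HT h (al + be).
Proof.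
move=> Ha Hb w i j lt_ji; rewrite !ffunE opprD addrACA.
by apply: mdvdD; [apply: Ha | apply: Hb].
Qed.

Lemma HTM al be : HT h al -> HT h be -> HT h (mul_tuple al be).
Proof.
move=> Ha Hb w i j lt_ji; rewrite !ffunE; set w' := (tperm j i * w)%g.
have -> : al w * be w - al w' * be w' = (al w - al w') * be w + al w' * (be w - be w').
  by ring.
by apply: mdvdD; [apply/mdvdMr/Ha | apply/mdvdMl/Hb].
Qed.

Lemma HT_const p : HT h [ffun _ => p].
Proof. by move=> w i j _; rewrite !ffunE subrr; apply: mdvd0. Qed.

Lemma mdvd_msym (w : 'S_n) (a p : A) : mdvd a p -> mdvd (msym w a) (msym w p).
Proof. by case=> q ->; exists (msym w q); rewrite msymM. Qed.

(** The difference along an edge is [w] applied to p - (j i) p, which is a multiple of x_i - x_j. *)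
Lemma HT_inv p : HT h (inv_tuple p).
Proof.
move=> w i j _; rewrite !ffunE msymMm -msymB -!msym_var -msymB tpermC.
exact/mdvd_msym/msym_tperm_congr.
Qed.

Lemma HT_ideal0 : HT_ideal h 0.
Proof.
exists (fun _ => 0); split=> [i|]; first exact: HT0.
by rewrite big1 // => i _; apply/ffunP=> w; rewrite !ffunE mulr0.
Qed.

Lemma HT_idealD al be : HT_ideal h al -> HT_ideal h be -> HT_ideal h (al + be).
Proof.
case=> a [Ha ->] [b [Hb ->]]; exists (fun i => a i + b i).
split=> [i|]; first exact: HTD.
rewrite -big_split; apply: eq_bigr => i _.
by apply/ffunP=> w; rewrite !ffunE mulrDr.
Qed.

Lemma HT_idealM al ga : HT h ga -> HT_ideal h al -> HT_ideal h (mul_tuple ga al).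
Proof.
move=> Hg [a [Ha ->]]; exists (fun i => mul_tuple ga (a i)).
split=> [i|]; first exact: HTM.
apply/ffunP=> w; rewrite ffunE !sum_ffunE mulr_sumr.
by apply: eq_bigr => i _; rewrite !ffunE mulrCA.
Qed.

Lemma HT_idealZ a al : HT_ideal h al -> HT_ideal h (a *: al).
Proof.
move=> Ia; have := HT_idealM (HT_const a%:MP) Ia.
by congr (HT_ideal h _); apply/ffunP=> w; rewrite !ffunE mul_mpolyC.
Qed.

Lemma HT_ideal_sum (J : Type) (r : seq J) (P : pred J) F :
  (forall j, P j -> HT_ideal h (F j)) -> HT_ideal h (\sum_(j <- r | P j) F j).
Proof.
by move=> IF; elim/big_rec: _ => [|j al /IF]; [apply: HT_ideal0 | apply: HT_idealD].
Qed.

Lemma inv_tupleM p q : inv_tuple (p * q) = mul_tuple (inv_tuple p) (inv_tuple q).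
Proof. by apply/ffunP=> w; rewrite !ffunE msymM. Qed.

Lemma inv_tuple_lin a p q : inv_tuple (a *: p + q) = a *: inv_tuple p + inv_tuple q.
Proof. by apply/ffunP=> w; rewrite !ffunE msymD msymZ. Qed.

Definition inv_ideal (d : nat) p : Prop := HT_ideal h (inv_tuple p).

Lemma inv_ideal_graded : graded_ideal inv_ideal.
Proof.
split=> [d | d p q Ip Iq | d e p q _ Ip].
- rewrite /inv_ideal (_ : inv_tuple 0 = 0); first exact: HT_ideal0.
  by apply/ffunP=> w; rewrite !ffunE msym0.
- by rewrite /inv_ideal -[p]scale1r inv_tuple_lin scale1r; apply: HT_idealD.
by rewrite /inv_ideal inv_tupleM; apply: HT_idealM => //; apply: HT_inv.
Qed.

Lemma prodB_ord (x : A) (k i : 'I_n) :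
  \prod_(k.+1 <= l < i.+1) (x - var n l) = \prod_(l < n | (k < l <= i)%N) (x - 'X_l).
Proof.
rewrite big_geq_mkord (big_ord_widen_cond n (fun l => k < l)%N (fun l => x - var n l)) //.
by apply: eq_big => [l | l _]; rewrite ?var_ord // ltnS.
Qed.

Lemma rel_ord (k i : 'I_n) :
  hrel n (fun=> 1) 0 k i
  = \sum_(m < n | (m <= k)%N) 'X_m * \prod_(l < n | (k < l <= i)%N) ('X_m - 'X_l).
Proof.
pose F m := var n m * \prod_(k.+1 <= l < i.+1) (var n m - var n l).
rewrite /hrel big_mkord (big_ord_widen n (fun m => 1 *: F m)) //.
by apply: eq_big => [m | m _]; rewrite ?ltnS // scale1r /F var_ord prodB_ord.
Qed.

(* [rel_class k a w] is the coefficient of t_a when [inv_tuple] of the relation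
   at [k] is written as a combination of the constant tuples. *)
Definition rel_class (k a : 'I_n) : tuples :=
  [ffun w : 'S_n => if ((w^-1)%g a <= k)%N
     then \prod_(l < n | (k < l <= h k)%N) ('X_a - 'X_(w l)) else 0].

(** Let m = w^-1(a). If m is neither i nor j, transposing the variables of indices w(i) and w(j)
    exchanges the two values. If m is i or j, the values are equal unless j <= k < i; then i <= h(j)
    <= h(k), and the nonzero value contains the required factor up to sign. *)
Lemma HT_rel_class k a : HT h (rel_class k a).
Proof.
move=> w i j /andP[lt_ji le_ih]; rewrite !ffunE.
set t := tperm j i.
have -> : ((t * w)^-1)%g a = t ((w^-1)%g a) by rewrite invMg tpermV permM.
set m := (w^-1)%g a; have Da : a = w m by rewrite permKV.
set D := \prod_(l < n | _) _.
have -> : \prod_(l < n | (k < l <= h k)%N) ('X_a - 'X_((t * w)%g l))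
        = \prod_(l < n | (k < l <= h k)%N) ('X_a - 'X_(w (t l))) :> A.
  by apply: eq_bigr => l _; rewrite permM.
set D' := \prod_(l < n | _) _.
have dvdD (k' : 'I_n) (f : 'I_n -> A) (b : A): (k < k' <= h k)%N -> mdvd b (f k') ->
    mdvd b (\prod_(l < n | (k < l <= h k)%N) f l).
  by move=> ltk' bf; rewrite (bigD1 k') //=; apply: mdvdMr.
have le_ihk : (j <= k)%N -> (i <= h k)%N.
  by move=> le_jk; apply: leq_trans le_ih _; rewrite -!hess_natE hess_nat_mono ?le_jk /=.
have DD' : (i <= k)%N -> D = D'.
  move=> le_ik; apply: eq_bigr => l /andP[lt_kl _]; rewrite tpermD //.
    by rewrite neq_ltn (leq_trans lt_ji) // ltnW // (leq_ltn_trans le_ik).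
  by rewrite neq_ltn (leq_ltn_trans le_ik).
have [Dm | ne_mj] := eqVneq m j.
  rewrite Dm tpermL; case: (leqP i k) => [le_ik | lt_ki].
    by rewrite (leq_trans (ltnW lt_ji) le_ik) DD' // subrr; apply: mdvd0.
  case: leqP => [le_jk | _]; last by rewrite subrr; apply: mdvd0.
  rewrite subr0; apply: (dvdD i); first by rewrite lt_ki le_ihk.
  by rewrite Da Dm; apply/mdvdBC/mdvd_refl.
have [Dm | ne_mi] := eqVneq m i.
  rewrite Dm tpermR; case: (leqP i k) => [le_ik | lt_ki].
    by rewrite (leq_trans (ltnW lt_ji) le_ik) DD' // subrr; apply: mdvd0.
  case: leqP => [le_jk | _]; last by rewrite subrr; apply: mdvd0.
  rewrite sub0r; apply: mdvdN; apply: (dvdD i); first by rewrite lt_ki le_ihk.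
  by rewrite Da Dm tpermR; apply: mdvd_refl.
rewrite tpermD 1?eq_sym //; case: ifP => _; last by rewrite subrr; apply: mdvd0.
have -> : D' = msym (tperm (w i) (w j)) D.
  rewrite rmorph_prod; apply: eq_bigr => l _; rewrite rmorphB /= !msym_var.
  congr ('X__ - 'X__).
    by rewrite tpermD // Da (inj_eq perm_inj) eq_sym.
  by rewrite /t tpermC inj_tperm //; apply: perm_inj.
exact: msym_tperm_congr.
Qed.

Lemma inv_ideal_rel (k : 'I_n) d : inv_ideal d (hrel n (fun=> 1) 0 k (h k)).
Proof.
exists (rel_class k); split=> [a|]; first exact: HT_rel_class.
apply/ffunP=> w; rewrite sum_ffunE ffunE rel_ord rmorph_sum /=.
rewrite (reindex (fun a => (w^-1)%g a)) /=; last first.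
  by exists w => a _; rewrite ?permK ?permKV.
rewrite big_mkcond /=; apply: eq_bigr => a _; rewrite !ffunE.
case: ifP => _; last by rewrite mulr0.
rewrite rmorphM rmorph_prod /= msym_var permKV; congr (_ * _).
by apply: eq_bigr => l _; rewrite rmorphB /= !msym_var permKV.
Qed.

Lemma inv_relations :
  relations hess_nat (fun=> 1) 0 (hess_nat 0 - 0) inv_ideal.
Proof.
split=> [|lt_0n|k /andP[_ lt_kn]|//]; first exact: inv_ideal_graded.
  rewrite add0n subn0 (hess_natE (Ordinal lt_0n)).
  exact: (inv_ideal_rel (Ordinal lt_0n)).
rewrite (hess_natE (Ordinal lt_kn)); exact: (inv_ideal_rel (Ordinal lt_kn)).
Qed.

End InvariantTuples.

(** * Localization *)

Section FixedPointIntegral.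
Variables (n : nat) (h : 'I_n -> 'I_n).
Hypothesis hess_h : Hessenberg h.
Local Notation A := {mpoly rat[n]}.
Local Notation tuples := (tuples n).
Implicit Types (p q g : A) (al be ga : tuples).

Definition edge_prod : A :=
  \prod_(i < n) \prod_(j < n | (i < j <= h i)%N) ('X_i - 'X_j).

Definition nonedge_prod : A :=
  \prod_(i < n) \prod_(j < n | (i < j)%N && (h i < j)%N) ('X_i - 'X_j).

Lemma vandermonde_edges : vandermonde n = edge_prod * nonedge_prod.
Proof.
rewrite /vandermonde -big_split; apply: eq_bigr => i _.
rewrite (bigID (fun j : 'I_n => j <= h i)%N) /=; congr (_ * _).
by apply: eq_bigl => j; rewrite -ltnNge.
Qed.

(* The numerator of the localization sum over the fixed points w of
   al(w) / msym w edge_prod, over the common denominator [vandermonde]. *)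
Definition fixed_sum al : A :=
  \sum_(w : 'S_n) (-1) ^+ w *: (al w * msym w nonedge_prod).

(** On an edge this is the divisibility condition for the product of [al] with the class of
    [nonedge_prod]. Off the edges, x_j - x_i is a factor of [nonedge_prod], and both terms are
    divisible separately. *)
Lemma fixed_sum_pair al (w : 'S_n) (i j : 'I_n) : HT h al -> (j < i)%N ->
  mdvd ('X_(w i) - 'X_(w j))
    (al w * msym w nonedge_prod
     - al (tperm j i * w)%g * msym (tperm j i * w)%g nonedge_prod).
Proof.
move=> Ha lt_ji; case: (leqP i (h j)) => [le_ih | lt_hi].
  have : HT h (mul_tuple al (inv_tuple nonedge_prod)) by apply/HTM/HT_inv.
  by move/(_ w i j); rewrite !ffunE lt_ji le_ih; apply.
have [c Dc] : mdvd ('X_j - 'X_i) nonedge_prod.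
  rewrite /nonedge_prod (bigD1 j) //= (bigD1 i) ?lt_ji //=.
  by do 2 apply: mdvdMr; apply: mdvd_refl.
apply: mdvdB; apply: mdvdMl; rewrite Dc; [apply: mdvdBC | ];
  rewrite msymM; apply: mdvdMl; rewrite msymB !msym_var ?permM ?tpermL ?tpermR;
  exact: mdvd_refl.
Qed.

(** Pairing [w] with [w * tperm a b], of opposite sign, turns twice the sum into a sum of
    differences covered by [fixed_sum_pair]. *)
Lemma fixed_sum_tperm al (a b : 'I_n) : a != b -> HT h al ->
  mdvd ('X_a - 'X_b) (fixed_sum al).
Proof.
move=> ne_ab Ha.
have -> : fixed_sum al = 2^-1 *: (fixed_sum al + fixed_sum al).
  by rewrite -mulr2n -scaler_nat scalerA mulVf ?scale1r.
rewrite {2}/fixed_sum (reindex_inj (mulIg (tperm a b))) /= -big_split /=.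
apply/mdvdZ/mdvd_sum => w _.
set i := (w^-1)%g a; set j := (w^-1)%g b.
have Da : a = w i by rewrite permKV.
have Db : b = w j by rewrite permKV.
have ne_ij : i != j by rewrite (inj_eq perm_inj).
have -> : (w * tperm a b = tperm i j * w)%g.
  by apply/permP => l; rewrite !permM Da Db inj_tperm //; apply: perm_inj.
rewrite odd_mul_tperm ne_ij signr_addb expr1 mulN1r scaleNr -scalerBr.
apply: mdvdZ; case: (ltngtP i j) ne_ij => [lt_ij _|lt_ji _|/val_inj ->];
  last by rewrite eqxx.
  by rewrite Da Db; apply/mdvdBC/fixed_sum_pair.
by rewrite tpermC Da Db; apply: fixed_sum_pair.
Qed.

Lemma fixed_sum_vandermonde al : HT h al -> mdvd (vandermonde n) (fixed_sum al).
Proof.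
move=> Ha; rewrite vandermonde_pairs; apply: mdvd_coprime.
- by rewrite filter_uniq // index_enum_uniq.
- exact: filter_all.
move=> [i j]; rewrite mem_filter /= => /andP[lt_ij _]; apply: fixed_sum_tperm => //.
by rewrite neq_ltn lt_ij.
Qed.

(** The localization integral is the constant term of the quotient of [fixed_sum] by [vandermonde].
    Pairing with the coefficients of [vandermonde] extracts it without division, up to the sum of
    their squares. *)
Definition integral p : rat :=
  \sum_(m <- msupp (vandermonde n)) (vandermonde n)@_m * (fixed_sum (inv_tuple p))@_m.

Lemma integral_linear : linear_form integral.
Proof.
move=> a p q; rewrite /integral mulr_sumr -big_split; apply: eq_bigr => m _ /=.
rewrite mulrCA -mulrDr; congr (_ * _); rewrite -mcoeffZ -mcoeffD; congr (_ @_ _).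
rewrite /fixed_sum scaler_sumr -big_split; apply: eq_bigr => w _ /=.
rewrite !ffunE scalerA [a * _]mulrC -scalerA -scalerDr; congr (_ *: _).
by rewrite msymD msymZ mulrDl scalerAl.
Qed.

Lemma mcoeffM_homog_var D V q (i : 'I_n) m :
  V \is [in rat[n], D.-homog] -> mdeg m = D -> ('X_i * (q * V))@_m = 0.
Proof.
move=> hV dm; rewrite [q]mpolyE mulr_suml mulr_sumr raddf_sum big1 //= => k _.
have hk : 'X_i * (q@_k *: 'X_[k] * V) \is (1 + (mdeg k + D)).-homog.
  apply: dhomogM; first by rewrite dhomogX /= mdeg1.
  by apply: dhomogM => //; rewrite dhomogZ // dhomogX /=.
by rewrite (dhomog_nemf_coeff hk) //= dm; apply/eqP; lia.
Qed.

(** The fixed sum is a combination of multiples of the products x_i [vandermonde], whose monomials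
    exceed the degree of [vandermonde]. *)
Lemma integral_ideal p : HT_ideal h (inv_tuple p) -> integral p = 0.
Proof.
case=> b [Hb Dp]; rewrite /integral big_seq big1 // => m mV.
have [D hV] := vandermonde_homog n.
have -> : fixed_sum (inv_tuple p) = \sum_(i < n) 'X_i * fixed_sum (b i).
  rewrite Dp /fixed_sum; under [RHS]eq_bigr do rewrite mulr_sumr.
  rewrite exchange_big /=; apply: eq_bigr => w _.
  rewrite sum_ffunE mulr_suml scaler_sumr; apply: eq_bigr => i _.
  by rewrite ffunE -scalerAr mulrA.
rewrite raddf_sum big1 ?mulr0 // => i _ /=.
have [q ->] := fixed_sum_vandermonde (Hb i).
by rewrite (mcoeffM_homog_var _ _ hV) // (dhomog_mf hV).
Qed.

Lemma integral_annihilator d p : inv_ideal h d p -> annihilator integral d p.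
Proof.
by move=> Ip g; rewrite mulrC integral_ideal // inv_tupleM; apply/HT_idealM/Ip/HT_inv.
Qed.

Definition edge_count : nat := (\sum_(i < n) (h i - i))%N.

Lemma card_between (i k : 'I_n) : (\sum_(j < n | (i < j <= k)%N) 1 = k - i)%N.
Proof.
rewrite (eq_bigl (fun j : 'I_n => (i < j)%N && (j < k.+1)%N)) //.
rewrite -(big_ord_widen_cond n (fun j => i < j)%N (fun=> 1%N)) ?ltn_ord //.
by rewrite -subSS -[RHS]muln1 -sum_nat_const_nat big_geq_mkord.
Qed.

Lemma edge_prod_homog : edge_prod \is edge_count.-homog.
Proof.
apply: dhomog_bigprod => i _; rewrite -card_between.
by apply: dhomog_bigprod => j _; apply: mpolyXB_homog.
Qed.

Lemma integral_small d p : (d < edge_count)%N -> p \is d.-homog -> integral p = 0.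
Proof.
move=> lt_d hp; rewrite /integral big_seq big1 // => m mV.
have [D hc] : exists D, nonedge_prod \is D.-homog.
  exists (\sum_(i < n) \sum_(j < n | (i < j)%N && (h i < j)%N) 1)%N.
  by do 2 apply: dhomog_bigprod => ? _; apply: mpolyXB_homog.
have hV : vandermonde n \is (edge_count + D).-homog.
  by rewrite vandermonde_edges; apply: dhomogM => //; apply: edge_prod_homog.
have hs : fixed_sum (inv_tuple p) \is (d + D).-homog.
  apply: rpred_sum => w _; rewrite dhomogZ // ffunE.
  by apply: dhomogM; apply: msym_homog.
rewrite (dhomog_nemf_coeff hs) ?mulr0 //= (dhomog_mf hV) //.
by apply/eqP; lia.
Qed.

(** Each permutation contributes [vandermonde] itself, the two signs cancelling; the value is n!
    times a nonzero sum of squares. *)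
Lemma integral_edge_prod : integral edge_prod != 0.
Proof.
have -> : integral edge_prod
        = (n`!)%:R * \sum_(m <- msupp (vandermonde n)) (vandermonde n)@_m ^+ 2.
  rewrite /integral mulr_sumr; apply: eq_bigr => m _.
  have -> : fixed_sum (inv_tuple edge_prod) = vandermonde n *+ n`!.
    rewrite -card_Sn -sumr_const; apply: eq_bigr => w _.
    rewrite ffunE -msymM -vandermonde_edges msym_vandermonde scalerA.
    by rewrite -signr_addb addbb scale1r.
  by rewrite mcoeffMn mulrnAr mulr_natl expr2.
apply: mulf_neq0; first by rewrite pnatr_eq0 -lt0n fact_gt0.
rewrite psumr_neq0 => [|m _]; last exact: sqr_ge0.
have [m mV] : exists m, m \in msupp (vandermonde n).
  case: (msupp _) (msupp_eq0 (vandermonde n)) => [|m s _].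
    by rewrite eqxx (negPf (vandermonde_neq0 n)).
  by exists m; rewrite mem_head.
by apply/hasP; exists m => //=; rewrite exprn_even_gt0 //= -mcoeff_msupp.
Qed.

Lemma bastop_edge_prod : bastop n (hess_nat h) 0 n = edge_prod.
Proof.
have bE s m : bastop n (hess_nat h) s m
    = \prod_(s <= k < s + m)
        \prod_(k.+1 <= l < (k + (hess_nat h k - k)).+1) (var n k - var n l).
  elim: m s => [|m IHm] s /=; first by rewrite addn0 big_geq.
  by rewrite addnS big_ltn ?ltnS ?leq_addr // -addSn IHm.
rewrite bE add0n big_mkord; apply: eq_bigr => i _.
by rewrite hess_natE subnKC ?le_hess // var_ord prodB_ord.
Qed.

Lemma basdeg_edge_count : basdeg (hess_nat h) 0 n = edge_count.
Proof.
have bE s m : basdeg (hess_nat h) s m = (\sum_(s <= k < s + m) (hess_nat h k - k))%N.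
  elim: m s => [|m IHm] s /=; first by rewrite addn0 big_geq.
  by rewrite addnS big_ltn ?ltnS ?leq_addr // -addSn IHm.
by rewrite bE add0n big_mkord; apply: eq_bigr => i _; rewrite hess_natE.
Qed.

Local Notation basis := (bas n (hess_nat h) 0 n).

Lemma inv_basis_spans d p : p \is d.-homog ->
  exists a, HT_ideal h (inv_tuple (p - lin (basis d) a)).
Proof.
move=> hp; have [] := basis_spans (hess_nat_bounds hess_h) (hess_nat_mono hess_h)
    (add0n n) (c := fun=> 1) _ (inv_relations hess_h) hp; first by move=> *; apply: ltr01.
by move=> a; exists a.
Qed.

Lemma inv_basis_independent d a : HT_ideal h (inv_tuple (lin (basis d) a)) ->
  forall k, (k < size (basis d))%N -> a k = 0.
Proof.
move=> Ia; apply: (basis_independent (hess_nat_bounds hess_h) (hess_nat_mono hess_h)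
    (add0n n) (c := fun=> 1) (L := integral)) => //.
- exact: integral_linear.
- apply: relations_sub (inv_relations hess_h); last exact: integral_annihilator.
  exact/annihilator_ideal/integral_linear.
- by move=> e p; rewrite basdeg_edge_count; apply: integral_small.
- by rewrite bastop_edge_prod integral_edge_prod.
exact: integral_annihilator.
Qed.

End FixedPointIntegral.

(** * The multiplicity of the trivial representation *)

Section InvariantMultiplicity.
Variables (n : nat) (h : 'I_n -> 'I_n).
Hypothesis hess_h : Hessenberg h.
Local Notation A := {mpoly rat[n]}.
Local Notation tuples := (tuples n).
Local Notation basis := (bas n (hess_nat h) 0 n).
Implicit Types (p q : A) (al be : tuples).

Lemma HT_dot v al : HT h al -> HT h (dot_action v al).
Proof.
move=> Ha w i j lt_ji; rewrite !ffunE -mulgA.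
have := mdvd_msym v (Ha (w * v^-1)%g i j lt_ji).
by rewrite !msymB !msym_var !permM !permKV.
Qed.

Lemma dot_lin v a al be :
  dot_action v (a *: al + be) = a *: dot_action v al + dot_action v be.
Proof. by apply/ffunP => w; rewrite !ffunE msymD msymZ. Qed.

Lemma HT_ideal_dot v al : HT_ideal h al -> HT_ideal h (dot_action v al).
Proof.
case=> b [Hb ->]; exists (fun i => dot_action v (b ((v^-1)%g i))).
split=> [i|]; first exact: HT_dot.
apply/ffunP=> w; rewrite sum_ffunE !ffunE sum_ffunE raddf_sum /=.
rewrite (reindex_inj (@perm_inj _ v^-1)) /=; apply: eq_bigr => i _.
by rewrite !ffunE msymM msym_var permKV.
Qed.

Lemma dot_inv_tuple v p : dot_action v (inv_tuple p) = inv_tuple p.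
Proof. by apply/ffunP=> w; rewrite !ffunE -msymMm mulgKV. Qed.

(** Averaging lands in the classes of polynomials, so [inv_basis_spans] applies to the invariants of
    the quotient. *)
Lemma sum_dot_inv_tuple al :
  \sum_v dot_action v al = inv_tuple (\sum_v msym v (al (v^-1)%g)).
Proof.
apply/ffunP=> w; rewrite sum_ffunE ffunE raddf_sum /=.
rewrite (reindex_inj (mulIg w)) /=; apply: eq_bigr => v _.
by rewrite ffunE -msymMm invMg mulKVg.
Qed.

Definition equiv_mod al be : Prop := HT_ideal h (al - be).

Lemma equiv_mod_refl al : equiv_mod al al.
Proof. by rewrite /equiv_mod subrr; apply: HT_ideal0. Qed.

Lemma equiv_mod_sym al be : equiv_mod al be -> equiv_mod be al.
Proof.
rewrite /equiv_mod -opprB -scaleN1r => /(HT_idealZ (-1)).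
by rewrite scalerA mulN1r opprK scale1r.
Qed.

Lemma equiv_mod_trans be al ga : equiv_mod al be -> equiv_mod be ga -> equiv_mod al ga.
Proof. by move=> ab /(HT_idealD ab); rewrite addrA subrK. Qed.

Lemma equiv_mod_sum (J : Type) (r : seq J) (a : J -> rat) F G :
  (forall j, equiv_mod (F j) (G j)) ->
  equiv_mod (\sum_(j <- r) a j *: F j) (\sum_(j <- r) a j *: G j).
Proof.
move=> FG; rewrite /equiv_mod -sumrB; apply: HT_ideal_sum => j _.
by rewrite -scalerBr; apply/HT_idealZ/FG.
Qed.

Lemma dot_sum (J : Type) (r : seq J) (a : J -> rat) (F : J -> tuples) v :
  dot_action v (\sum_(j <- r) a j *: F j) = \sum_(j <- r) a j *: dot_action v (F j).
Proof.
elim: r => [|j r IHr]; last by rewrite !big_cons dot_lin IHr.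
by rewrite !big_nil; apply/ffunP => w; rewrite !ffunE msym0.
Qed.

Lemma inv_tuple_sum (J : Type) (r : seq J) (a : J -> rat) (F : J -> A) :
  inv_tuple (\sum_(j <- r) a j *: F j) = \sum_(j <- r) a j *: inv_tuple (F j).
Proof.
elim: r => [|j r IHr]; last by rewrite !big_cons inv_tuple_lin IHr.
by rewrite !big_nil; apply/ffunP => w; rewrite !ffunE msym0.
Qed.

Lemma equiv_mod_dot v al be :
  equiv_mod al be -> equiv_mod (dot_action v al) (dot_action v be).
Proof.
move/(HT_ideal_dot v); rewrite -scaleN1r addrC dot_lin scaleN1r addrC.
exact.
Qed.

Lemma equiv_modE p q :
  equiv_mod (inv_tuple p) (inv_tuple q) = HT_ideal h (inv_tuple (p - q)).
Proof.
by rewrite /equiv_mod -[p - q]addrC -[- q]scaleN1r inv_tuple_lin scaleN1r addrC.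
Qed.

Lemma sum_scale_exchange (J : finType) m (r : seq J)
    (a : J -> rat) (c : J -> 'I_m -> rat) (b : 'I_m -> tuples) :
  \sum_(j <- r) a j *: (\sum_i c j i *: b i) = \sum_i (\sum_(j <- r) a j * c j i) *: b i.
Proof.
under eq_bigr do rewrite scaler_sumr.
rewrite exchange_big /=; apply: eq_bigr => i _; rewrite scaler_suml.
by apply: eq_bigr => j _; rewrite scalerA.
Qed.

(** Let [C] express the r invariant basis classes in the basis [b], and [D] the sums of the v b_l in
    the invariant classes. From M(v) C = C and sum_v M(v) = C D follows C D C = n! C. Independence
    of the invariant classes cancels [C] on the left, so D C = n! and the trace of C D is n! r. *)
Lemma H_character_average j chi : H_character h j chi ->
  (n`!%:R)^-1 * \sum_v chi v = (size (basis j))%:R.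
Proof.
case=> m [b [M [[bdeg bspan bfree] Mact Dchi]]].
set r := size _; pose p (k : 'I_r) := (basis j)`_k.
have hp k : p k \is j.-homog by apply: (@bas_homog n (hess_nat h) 0 n); apply: mem_nth.
have bfree' (f g : 'I_m -> rat) :
    equiv_mod (\sum_k f k *: b k) (\sum_k g k *: b k) -> f =1 g.
  move=> fg k; have fg0 : HT_ideal h (\sum_l (f l - g l) *: b l).
    by congr (HT_ideal h _): fg; rewrite -sumrB; apply: eq_bigr => l _; rewrite scalerBl.
  by apply/eqP; rewrite -subr_eq0 (bfree _ fg0 k).
have /fin_all_exists[c0 Dc] (k : 'I_r) : exists c : 'I_m -> rat,
    equiv_mod (inv_tuple (p k)) (\sum_l c l *: b l).
  apply: bspan; split; first exact: HT_inv.
  by move=> w; rewrite ffunE; apply: (msym_homog w (hp k)).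
have /fin_all_exists[d0 Dd] (l : 'I_m) : exists d : nat -> rat,
    equiv_mod (\sum_v dot_action v (b l)) (\sum_(k < r) d k *: inv_tuple (p k)).
  rewrite sum_dot_inv_tuple.
  set u := \sum_v _; have hu : u \is j.-homog.
    by apply: rpred_sum => v _; apply: msym_homog; case: (bdeg l).
  have [a Ia] := inv_basis_spans hess_h hu; exists a.
  by rewrite -inv_tuple_sum equiv_modE.
pose C : 'M[rat]_(m, r) := \matrix_(l, k) c0 k l.
pose D : 'M[rat]_(r, m) := \matrix_(k, l) d0 l k.
have MC v : M v *m C = C.
  apply/matrixP => k i; rewrite [LHS]mxE [RHS]mxE; apply/esym; move: k.
  apply: bfree'; apply: equiv_mod_trans (equiv_mod_sym (Dc i)) _.
  rewrite -(dot_inv_tuple v).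
  apply: equiv_mod_trans (equiv_mod_dot v (Dc i)) _; rewrite dot_sum.
  apply: equiv_mod_trans (equiv_mod_sum _ (c0 i) (Mact v)) _.
  rewrite sum_scale_exchange.
  congr (equiv_mod _ _): (equiv_mod_refl (\sum_k (M v *m C) k i *: b k)).
    apply: eq_bigr => k _; rewrite mxE; congr (_ *: _).
    by apply: eq_bigr => l _; rewrite mxE mulrC.
  by apply: eq_bigr => k _; rewrite mxE.
have CD : \sum_v M v = C *m D.
  apply/matrixP => k l; rewrite summxE [RHS]mxE; move: k; apply: bfree'.
  apply: (@equiv_mod_trans (\sum_v dot_action v (b l))).
    apply: equiv_mod_sym.
    have := equiv_mod_sum (index_enum _) (fun=> 1) (fun v => Mact v l).
    rewrite sum_scale_exchange; under eq_bigr do rewrite scale1r.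
    by under [X in equiv_mod _ X]eq_bigr do under eq_bigr do rewrite mul1r.
  apply: equiv_mod_trans (Dd l) _.
  apply: equiv_mod_trans (equiv_mod_sum _ (fun k : 'I_r => d0 l k) Dc) _.
  rewrite sum_scale_exchange.
  congr (equiv_mod _ _): (equiv_mod_refl (\sum_k (C *m D) k l *: b k)).
    apply: eq_bigr => k _; rewrite mxE; congr (_ *: _).
    by apply: eq_bigr => i _; rewrite !mxE mulrC.
  by apply: eq_bigr => k _; rewrite mxE.
have CDC : C *m D *m C = n`!%:R *: C.
  rewrite -CD mulmx_suml; under eq_bigr do rewrite MC.
  by rewrite sumr_const card_Sn scaler_nat.
have DC : D *m C = n`!%:R%:M.
  apply/eqP; rewrite -subr_eq0; apply/eqP; set Y := _ - _.
  have CY : C *m Y = 0 by rewrite mulmxBr mulmxA CDC mul_mx_scalar subrr.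
  apply/matrixP => k q; rewrite [RHS]mxE.
  (* A column of [Y], extended by 0 to the [nat]-indexed coefficients that [lin] takes. *)
  pose a i := if insub i is Some i' then Y (i' : 'I_r) q else 0.
  have aE (i : 'I_r) : a i = Y i q by rewrite /a valK.
  rewrite -aE; apply: (inv_basis_independent hess_h (d := j)) (ltn_ord k).
  rewrite /lin inv_tuple_sum -[X in HT_ideal h X]subr0.
  apply: equiv_mod_trans (equiv_mod_sum _ (fun i : 'I_r => a i) Dc) _.
  rewrite sum_scale_exchange big1; first exact: equiv_mod_refl.
  move=> l _; have /matrixP/(_ l q) := CY; rewrite !mxE.
  under eq_bigr do rewrite mxE mulrC -aE.
  by move=> ->; rewrite scale0r.
under eq_bigr do rewrite Dchi.
rewrite -raddf_sum /= CD mxtrace_mulC DC mxtrace_scalar -[_ *+ r]mulr_natr mulrA.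
rewrite mulVf ?mul1r //.
by rewrite pnatr_eq0 -lt0n fact_gt0.
Qed.

End InvariantMultiplicity.

(** * Colorings *)

Section WeightedColorings.
Implicit Types (n m k c : nat).

(** The weight of an edge whose smaller endpoint has colour [a]: an ascent counts t, and a
    monochromatic edge kills the coloring. *)
Definition cmp_weight a b : {poly rat} :=
  if a == b then 0 else if (a < b)%N then 'X else 1.

Definition coloring_weight n (H : nat -> nat) (f : 'I_n -> nat) : {poly rat} :=
  \prod_(i < n) \prod_(j < n | (i < j <= H i)%N) cmp_weight (f i) (f j).

Definition surj n k (f : {ffun 'I_n -> 'I_k}) : bool := [forall c, exists i, f i == c].

Definition fcons T n (c : T) (f : {ffun 'I_n -> T}) : {ffun 'I_n.+1 -> T} :=
  [ffun i => if unlift ord0 i is Some j then f j else c].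

Lemma fcons0 T n (c : T) (f : {ffun 'I_n -> T}) : fcons c f ord0 = c.
Proof. by rewrite ffunE unlift_none. Qed.

Lemma fcons_lift T n (c : T) (f : {ffun 'I_n -> T}) j : fcons c f (lift ord0 j) = f j.
Proof. by rewrite ffunE liftK. Qed.

Lemma big_fcons (T : finType) n (P : pred {ffun 'I_n.+1 -> T})
    (F : {ffun 'I_n.+1 -> T} -> {poly rat}) :
  \sum_(f | P f) F f
  = \sum_(c : T) \sum_(f : {ffun 'I_n -> T} | P (fcons c f)) F (fcons c f).
Proof.
rewrite pair_big_dep /= (reindex (fun x : T * {ffun 'I_n -> T} => fcons x.1 x.2)) //=.
exists (fun f => (f ord0, [ffun j => f (lift ord0 j)])) => [[c f] _ | f _] /=.
  by congr (_, _); rewrite ?fcons0 //; apply/ffunP => j; rewrite !ffunE liftK.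
apply/ffunP => i; rewrite ffunE; case: unliftP => [j -> | -> //].
by rewrite ffunE.
Qed.

Definition flift n k (c : 'I_k.+1) (f : {ffun 'I_n -> 'I_k}) : {ffun 'I_n -> 'I_k.+1} :=
  [ffun i => lift c (f i)].

Lemma flift_inj n k (c : 'I_k.+1) : injective (@flift n k c).
Proof.
move=> f g /ffunP fg; apply/ffunP => i; move: (fg i); rewrite !ffunE.
exact: lift_inj.
Qed.

Lemma surj_fcons_cases n k (c : 'I_k) (f : {ffun 'I_n -> 'I_k}) :
  surj (fcons c f) = surj f || [forall d, (d != c) == [exists i, f i == d]].
Proof.
have ex_fcons d : [exists i, fcons c f i == d] = (d == c) || [exists i, f i == d].
  apply/existsP/orP => [[i] | [/eqP-> | /existsP[i fid]]].
  - case: (unliftP ord0 i) => [j -> | ->]; rewrite ?fcons_lift ?fcons0 => fid.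
      by right; apply/existsP; exists j.
    by left; rewrite eq_sym.
  - by exists ord0; rewrite fcons0.
  by exists (lift ord0 i); rewrite fcons_lift.
apply/forallP/orP => [sf | [/forallP sf | /forallP sf] d]; rewrite ?ex_fcons; last first.
- by rewrite -(eqP (sf d)) orbN.
- by rewrite sf orbT.
case fc: [exists i, f i == c]; [left | right]; apply/forallP => d.
  by move: (sf d); rewrite ex_fcons; case: eqP => [-> | ].
by move: (sf d); rewrite ex_fcons; case: eqP => [-> | _ /= ->] //; rewrite fc.
Qed.

(** Either the first vertex joins a colour class of the others, or it is alone in its class; in the
    latter case the others use every colour but [c], and [flift c] relabels them. *)
Lemma surj_fcons n k (c : 'I_k.+1) (G : {ffun 'I_n -> 'I_k.+1} -> {poly rat}) :
  \sum_(f | surj (fcons c f)) G f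
  = \sum_(f | surj f) G f + \sum_(f : {ffun 'I_n -> 'I_k} | surj f) G (flift c f).
Proof.
rewrite (bigID (fun f : {ffun 'I_n -> 'I_k.+1} => surj f)) /=; congr (_ + _).
  by apply: eq_bigl => f; rewrite surj_fcons_cases; case: (surj f); rewrite ?andbF.
rewrite -[RHS](big_imset _ (in2W (@flift_inj n k c))) /=; apply: eq_bigl => f.
rewrite surj_fcons_cases; apply/andP/imsetP => [[fE nsf] | [g sg ->]].
  move: fE; rewrite (negPf nsf) /= => /forallP fE.
  have /fin_all_exists[g gE] (i : 'I_n) : exists d, f i = lift c d.
    have: f i != c by rewrite (eqP (fE (f i))); apply/existsP; exists i.
    by case: (unliftP c (f i)) => [d -> | ->]; [exists d | rewrite eqxx].
  have fg : f = flift c [ffun i => g i] by apply/ffunP => i; rewrite !ffunE gE.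
  exists [ffun i => g i] => //; apply/forallP => d.
  have := eqP (fE (lift c d)); rewrite eq_sym neq_lift => /esym/existsP[i].
  by rewrite gE (inj_eq lift_inj) => gid; apply/existsP; exists i; rewrite ffunE.
have fE : [forall d, (d != c) == [exists i, flift c g i == d]].
  apply/forallP => d; case: (unliftP c d) => [d' -> | ->].
    rewrite [lift c d' == c]eq_sym neq_lift; case/forallP/(_ d')/existsP: sg => i gid.
    by apply/eqP/esym/existsP; exists i; rewrite ffunE (eqP gid).
  rewrite eqxx; apply/eqP/esym/existsP => -[i]; rewrite ffunE.
  by rewrite eq_sym (negPf (neq_lift _ _)).
rewrite fE orbT; split=> //; apply/negP => /forallP/(_ c).
by rewrite -(eqP (forallP fE c)) eqxx.
Qed.

Lemma surj_leq n k (f : {ffun 'I_n -> 'I_k}) : surj f -> (k <= n)%N.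
Proof.
move=> /forallP sf; have /fin_all_exists[g gE] (c : 'I_k) : exists i, f i = c.
  by have /existsP[i /eqP fic] := sf c; exists i.
have ginj : injective g by move=> c d /(congr1 f); rewrite !gE.
by have := leq_card g ginj; rewrite !card_ord.
Qed.

(** In sorted order, an element with r members of [s] at or above it contributes t^r, for r from 1
    to [size s]; the added 1 is t^0. *)
Lemma sum_rank_weight (s : seq nat) : uniq s ->
  \sum_(a <- s) \prod_(b <- s) (if (a <= b)%N then 'X else 1) + 1 = tint (size s).+1.
Proof.
rewrite -(perm_uniq (permEl (perm_sort leq s))) -(size_sort leq s).
rewrite -(perm_big _ (permEl (perm_sort leq s))) /=.
under eq_bigr do rewrite -(perm_big _ (permEl (perm_sort leq s))) /=.
elim: (sort leq s) (sort_sorted leq_total s) => [|a t IHt] /=.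
  by move=> _ _; rewrite big_nil add0r /tint big_ord_recl big_ord0 expr0 addr0.
rewrite (path_sortedE leq_trans) => /andP[/allP ta st] /andP[a_t ut].
have Ea : \prod_(b <- t) (if (a <= b)%N then 'X else 1) = 'X^(size t) :> {poly rat}.
  rewrite big_seq; under eq_bigr => b bt do rewrite ta //.
  by rewrite -big_seq big_const_seq count_predT iter_mulr_1.
have Et : \sum_(b <- t) \prod_(b' <- a :: t) (if (b <= b')%N then 'X else 1)
        = \sum_(b <- t) \prod_(b' <- t) (if (b <= b')%N then 'X else 1) :> {poly rat}.
  rewrite big_seq [RHS]big_seq; apply: eq_bigr => b bt; rewrite big_cons leqNgt ltn_neqAle.
  by rewrite ta // andbT; case: eqP => [ab | _]; [move: a_t; rewrite ab bt | rewrite mul1r].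
rewrite big_cons Et big_cons leqnn Ea /tint big_ord_recr /= -/(tint _) -(IHt st ut) exprS.
by ring.
Qed.

(* Inserting a vertex adjacent to the colour classes s into an ordered partition
   with k blocks: joining block c needs c not in s, while opening a new block at
   c is always possible and cancels it, except when c is in s or c = k. *)
Lemma sum_insertion k (s : seq nat) : uniq s -> (forall a, a \in s -> (a < k)%N) ->
  \sum_(c < k) \prod_(a <- s) cmp_weight c a
  - \sum_(c < k.+1) \prod_(a <- s) (if (c <= a)%N then 'X else 1) = - tint (size s).+1.
Proof.
move=> us sk; rewrite big_ord_recr /= -(sum_rank_weight us) [in RHS]opprD.
have -> : \prod_(a <- s) (if (k <= a)%N then 'X else 1) = 1 :> {poly rat}.
  by rewrite big_seq big1 // => a /sk; rewrite ltnNge => /negPf->.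
rewrite opprD addrA; congr (_ - 1).
set g := fun c => \prod_(a <- s) (if (c <= a)%N then 'X else 1) : {poly rat}.
rewrite -sumrB -(big_mkord predT (fun c => \prod_(a <- s) cmp_weight c a - g c)) -sumrN /=.
rewrite (bigID (mem s)) /= [X in _ + X]big1 ?addr0 => [|c cs].
  rewrite -big_filter (perm_big s) /=; last first.
    apply: uniq_perm => //; first by rewrite filter_uniq ?iota_uniq.
    move=> a; rewrite mem_filter mem_index_iota /=.
    by case: (boolP (a \in s)) => //= /sk ->.
  rewrite big_seq [RHS]big_seq; apply: eq_bigr => c cs.
  by rewrite (big_rem c cs) /= /cmp_weight eqxx mul0r sub0r.
apply/eqP; rewrite subr_eq0; apply/eqP; rewrite /g big_seq [RHS]big_seq.
apply: eq_bigr => a as_; rewrite /cmp_weight ltn_neqAle.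
by case: eqP => [ca | //]; move: cs; rewrite ca as_.
Qed.

End WeightedColorings.

(** * The alternating sum over surjective colorings *)

Section AlternatingSum.

Definition fweight n k (H : nat -> nat) (f : {ffun 'I_n -> 'I_k}) : {poly rat} :=
  coloring_weight H (fun i => f i).

Lemma fweight_fcons n k H (c : 'I_k) (f : {ffun 'I_n -> 'I_k}) :
  fweight H (fcons c f)
  = (\prod_(j < n | (j < H 0)%N) cmp_weight c (f j)) * fweight (fun i => (H i.+1).-1) f.
Proof.
rewrite /fweight /coloring_weight big_ord_recl; congr (_ * _).
  rewrite big_mkcond big_ord_recl /= mul1r [RHS]big_mkcond; apply: eq_bigr => j _.
  by rewrite fcons0 fcons_lift.
apply: eq_bigr => i _; rewrite big_mkcond big_ord_recl /= mul1r [RHS]big_mkcond.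
apply: eq_bigr => j _; rewrite !fcons_lift /bump /= !add1n ltnS.
by case: (H _) => [|m]; rewrite ?ltn0 ?andbF //= ?ltnS; case: ltnP => //; case: (j : nat).
Qed.

Lemma fweight_flift n k H (c : 'I_k.+1) (f : {ffun 'I_n -> 'I_k}) :
  fweight H (flift c f) = fweight H f.
Proof.
apply: eq_bigr => i _; apply: eq_bigr => j _; rewrite /cmp_weight !ffunE /=.
by rewrite (inj_eq (can_inj (bumpK c))) !ltnNge leq_bump2.
Qed.

Lemma cmp_weight_bump c a : cmp_weight c (bump c a) = if (c <= a)%N then 'X else 1.
Proof.
rewrite /cmp_weight /bump; case: (leqP c a) => [le_ca | lt_ac].
  by rewrite add1n ltnS le_ca ltn_eqF.
by rewrite add0n gtn_eqF // ltnNge ltnW.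
Qed.

Lemma alternating_surj n H :
    (forall k, (k < n)%N -> (k <= H k < n)%N) ->
    (forall k l, (k <= l < n)%N -> (H k <= H l)%N) ->
  \sum_(k < n.+1) (-1) ^+ k * \sum_(f : {ffun 'I_n -> 'I_k} | surj f) fweight H f
  = (-1) ^+ n * \prod_(i < n) tint (H i - i).+1.
Proof.
elim: n H => [|n IHn] H Hb Hm.
  rewrite big_ord_recl big_ord0 addr0 big_ord0 /= !mul1r (big_pred1 [ffun i => i]).
    by rewrite /fweight /coloring_weight big_ord0.
  move=> f; rewrite /= [RHS](_ : _ = true); first by apply/forallP => -[].
  by apply/eqP/ffunP => -[].
pose H' i := (H i.+1).-1.
have H'b k : (k < n)%N -> (k <= H' k < n)%N.
  by move=> lt_kn; have := Hb k.+1 lt_kn; rewrite /H'; lia.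
have H'm k l : (k <= l < n)%N -> (H' k <= H' l)%N.
  by move=> kln; have := Hm k.+1 l.+1 kln; rewrite /H'; lia.
pose S k := \sum_(f : {ffun 'I_n.+1 -> 'I_k} | surj f) fweight H f.
(* Given an ordered partition of the other vertices into [k] blocks, the first vertex joins a block
   in [U k] and opens a new one in [V k]. The latter gives [k.+1] blocks, hence the opposite
   sign. *)
pose U k := \sum_(f : {ffun 'I_n -> 'I_k} | surj f) \sum_(c < k) fweight H (fcons c f).
pose V k := \sum_(f : {ffun 'I_n -> 'I_k} | surj f)
              \sum_(c < k.+1) fweight H (fcons c (flift c f)).
have SE k : S k = U k + (if k is k'.+1 then V k' else 0).
  rewrite /S big_fcons; case: k => [|k].
    by rewrite big_ord0 addr0 /U big1 // => f _; rewrite big_ord0.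
  under eq_bigr do rewrite surj_fcons.
  by rewrite big_split /= exchange_big [X in _ + X]exchange_big.
have Un : U n.+1 = 0.
  by rewrite /U big_pred0 // => f; apply/negP => /surj_leq; rewrite ltnn.
transitivity (\sum_(k < n.+1) (-1) ^+ k * (U k - V k)).
  under eq_bigr do rewrite -/(S _) SE mulrDr.
  rewrite big_split /= big_ord_recr /= Un mulr0 addr0.
  rewrite [X in _ + X]big_ord_recl mulr0 add0r -big_split /=.
  by apply: eq_bigr => k _; rewrite /bump add1n exprS mulN1r mulNr -mulrBr.
rewrite exprS mulN1r mulNr big_ord_recl mulrCA subn0.
have -> : \prod_(i < n) tint (H (lift ord0 i) - lift ord0 i).+1
        = \prod_(i < n) tint (H' i - i).+1.
  by apply: eq_bigr => i _; rewrite /H' lift0; congr (tint _.+1); lia.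
rewrite -(IHn _ H'b H'm) mulr_sumr -sumrN; apply: eq_bigr => k _.
rewrite mulrCA -mulrN; congr (_ * _).
rewrite /U /V -sumrB mulr_sumr -sumrN; apply: eq_bigr => f _.
under eq_bigr do rewrite fweight_fcons -/H'.
under [X in _ - X]eq_bigr do rewrite fweight_fcons -/H' fweight_flift.
rewrite -!mulr_suml -mulrBl -mulNr.
have [-> | nz_f] := eqVneq (fweight H' f) 0; first by rewrite !mulr0.
congr (_ * _).
have le_H0 : (H 0%N <= n)%N by have /andP[_] := Hb 0%N isT; rewrite ltnS.
pose s := [seq nat_of_ord (f (widen_ord le_H0 j)) | j <- enum 'I_(H 0%N)].
have szs : size s = H 0%N by rewrite size_map size_enum_ord.
(* Vertex [j] of the smaller graph is vertex [j.+1] of the larger, so [s] lists the colours of the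
   neighbours of the first vertex. These form a clique by monotonicity of [H], and a repeated colour
   would make the weight 0. *)
have us : uniq s.
  have inj_f (i j : 'I_n) : (i < j)%N -> (j < H 0)%N -> f i != f j.
    move=> lt_ij lt_j; apply: contraNneq nz_f => fij.
    rewrite /fweight /coloring_weight (bigD1 i) //= (bigD1 j) /=.
      by rewrite fij /cmp_weight eqxx !mul0r.
    have := Hm 0%N i.+1; rewrite ltnS ltn_ord => /(_ isT); rewrite lt_ij /H'.
    by move: lt_ij lt_j; lia.
  rewrite map_inj_uniq ?enum_uniq // => i j /val_inj fij; apply: val_inj.
  case: (ltngtP i j) => // [lt_ij | lt_ji].
    by have := inj_f (widen_ord le_H0 i) (widen_ord le_H0 j) lt_ij (ltn_ord j); rewrite fij eqxx.
  by have := inj_f (widen_ord le_H0 j) (widen_ord le_H0 i) lt_ji (ltn_ord i); rewrite fij eqxx.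
have sk a : a \in s -> (a < k)%N by case/mapP => j _ ->; apply: ltn_ord.
rewrite -[in RHS]szs -(sum_insertion us sk); congr (_ - _); apply: eq_bigr => c _.
  by rewrite (big_ord_narrow le_H0) big_map big_enum.
rewrite (big_ord_narrow le_H0) big_map big_enum /=; apply: eq_bigr => j _.
by rewrite ffunE /= cmp_weight_bump.
Qed.

End AlternatingSum.

(** * Finite differences and the value of a polynomial at -1 *)

Section ValueAtMinusOne.

(** The [k]-th forward difference of [f] at 0. *)
Definition fdiff (f : nat -> rat) k : rat :=
  \sum_(j < k.+1) (-1) ^+ (k - j) * 'C(k, j)%:R * f j.

Lemma fdiff0 f : fdiff f 0 = f 0%N.
Proof. by rewrite /fdiff big_ord_recl big_ord0 addr0 !mul1r. Qed.

Lemma fdiffS f k : fdiff f k.+1 = fdiff (fun j => f j.+1 - f j) k.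
Proof.
rewrite /fdiff; under [RHS]eq_bigr do rewrite mulrBr.
rewrite sumrB big_ord_recl subn0 bin0 mulr1.
under eq_bigr do rewrite lift0 subSS binS natrD mulrDr mulrDl.
rewrite big_split /= addrA addrC; congr (_ + _).
rewrite big_ord_recr /= bin_small // mulr0 mul0r addr0.
rewrite [X in _ = - X]big_ord_recl opprD subn0 bin0 mulr1 exprS mulN1r mulNr.
congr (_ + _).
rewrite -sumrN; apply: eq_bigr => j _; rewrite lift0 -!mulNr; congr (_ * _ * _).
by rewrite -[RHS]mulN1r -exprS; congr (_ ^+ _); have := ltn_ord j; lia.
Qed.

(** This is p(X + 1), in a form to which the lemmas on linear factors apply. *)
Definition shift_poly (p : {poly rat}) : {poly rat} := p \Po ('X - (-1)%:P).

Lemma size_poly_diff (p : {poly rat}) n :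
  (size p <= n.+1)%N -> (size (shift_poly p - p)%R <= n)%N.
Proof.
move=> sp; apply/leq_sizeP => j le_nj; rewrite coefB.
have ss : size (shift_poly p) = size p by rewrite size_comp_poly2 // size_XsubC.
have [le_pj | lt_jp] := leqP (size p) j; first by rewrite !nth_default ?ss ?subrr.
have Dj : j = (size p).-1 by lia.
have := lead_coef_comp p (q := 'X - (-1)%:P); rewrite size_XsubC => /(_ isT).
by rewrite lead_coefXsubC expr1n mulr1 !lead_coefE ss -Dj => ->; rewrite subrr.
Qed.

(** Newton's expansion at -1, where the k-th binomial coefficient is (-1)^k. The induction rests on
    p(-1) = p(0) - q(-1) with q(X) = p(X + 1) - p(X). *)
Lemma sum_fdiff_horner (p : {poly rat}) n : (size p <= n.+1)%N ->
  \sum_(k < n.+1) (-1) ^+ k * fdiff (fun j => p.[j%:R]) k = p.[-1].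
Proof.
elim: n p => [|n IHn] p sp.
  rewrite big_ord_recl big_ord0 addr0 mul1r fdiff0.
  by rewrite [p]size1_polyC // !hornerC.
rewrite big_ord_recl mul1r fdiff0.
have sd := size_poly_diff sp; have := IHn _ sd.
rewrite hornerD hornerN horner_comp hornerXsubC subrr.
move/(congr1 (fun x => p.[0] - x)); rewrite subKr => <-.
congr (_ + _); rewrite -sumrN; apply: eq_bigr => k _.
rewrite lift0 exprS mulN1r mulNr fdiffS; congr (- (_ * _)).
apply: eq_bigr => j _; rewrite hornerD hornerN horner_comp hornerXsubC opprK.
by rewrite natr1.
Qed.

Definition bin_poly r : {poly rat} := (r`!%:R)^-1 *: \prod_(i < r) ('X - i%:R%:P).

Lemma size_bin_poly r : (size (bin_poly r) <= r.+1)%N.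
Proof.
apply: leq_trans (size_scale_leq _ _) _.
by rewrite -big_enum size_prod_XsubC size_enum_ord.
Qed.

Lemma bin_poly_nat r j : (bin_poly r).[j%:R] = 'C(j, r)%:R.
Proof.
rewrite hornerZ horner_prod; under eq_bigr do rewrite hornerXsubC.
have nz : r`!%:R != 0 :> rat by rewrite pnatr_eq0 -lt0n fact_gt0.
apply: (mulfI nz); rewrite mulrA mulfV // mul1r mulrC -natrM bin_ffact ffact_prod.
have [le_rj | lt_jr] := leqP r j.
  rewrite natr_prod; apply: eq_bigr => i _; rewrite natrB //.
  by apply: leq_trans le_rj; apply: ltnW.
rewrite (bigD1 (Ordinal lt_jr)) //= subrr mul0r (bigD1 (Ordinal lt_jr)) //=.
by rewrite subnn mul0n.
Qed.

Lemma bin_poly_N1 r : (bin_poly r).[-1] = (-1) ^+ r.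
Proof.
rewrite hornerZ horner_prod; under eq_bigr do rewrite hornerXsubC.
have nz : r`!%:R != 0 :> rat by rewrite pnatr_eq0 -lt0n fact_gt0.
apply: (mulfI nz); rewrite mulrA mulfV // mul1r fact_prod big_add1 /= big_mkord.
have -> : (-1) ^+ r = \prod_(i < r) -1 :> rat by rewrite prodr_const card_ord.
rewrite natr_prod mulrC -big_split /=.
by apply: eq_bigr => i _; rewrite mulN1r -natr1 opprD addrC.
Qed.

(** The product is e_la at j ones, a polynomial in j of degree at most n. At -1 its factors are the
    signs (-1)^(la_i), and the parts add up to n. *)
Lemma sum_fdiff_bin n (la : partition_of n) :
  \sum_(k < n.+1) (-1) ^+ k * fdiff (fun j => \prod_(i < n) 'C(j, part la i)%:R) k
  = (-1) ^+ n.
Proof.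
have sum_la : (\sum_(i < n) part la i = n)%N.
  by case/andP: (valP la) => _ /eqP.
pose p := \prod_(i < n) bin_poly (part la i).
have sp : (size p <= n.+1)%N.
  rewrite -[in X in (_ <= X)%N]sum_la /p; elim/big_rec2: _ => [|i m q _ sq].
    by rewrite size_poly1.
  apply: leq_trans (size_polyMleq _ _) _.
  by have := size_bin_poly (part la i); move: sq; lia.
transitivity p.[-1].
  rewrite -(sum_fdiff_horner sp); apply: eq_bigr => k _; congr (_ * _).
  apply: eq_bigr => j _; congr (_ * _); rewrite horner_prod.
  by apply: eq_bigr => i _; rewrite bin_poly_nat.
rewrite horner_prod -[in RHS]sum_la expr_sum.
by apply: eq_bigr => i _; apply: bin_poly_N1.
Qed.

End ValueAtMinusOne.

(** * Specializations of the chromatic quasisymmetric function *)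

Section ChromaticEvaluation.
Variables (n : nat) (h : 'I_n -> 'I_n).
Hypothesis hess_h : Hessenberg h.

Definition edge_pair : pred ('I_n * 'I_n) := fun p => (p.1 < p.2 <= h p.1)%N.

Lemma set2_ltn_inj (p q : 'I_n * 'I_n) : (p.1 < p.2)%N -> (q.1 < q.2)%N ->
  [set p.2; p.1] = [set q.2; q.1] -> p = q.
Proof.
case: p q => [a b] [i j] /= lt_ab lt_ij E.
have: a \in [set j; i] by rewrite -E !inE eqxx orbT.
have: b \in [set j; i] by rewrite -E !inE eqxx.
rewrite !inE => /orP[] /eqP Db /orP[] /eqP Da; rewrite Da Db // in lt_ab *.
- by rewrite ltnn in lt_ab.
- by move: lt_ab lt_ij; lia.
by rewrite ltnn in lt_ab.
Qed.

Lemma edgesE : edges h = [set [set p.2; p.1] | p in edge_pair].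
Proof.
apply/setP => e; apply/imsetP/imsetP => -[[i j]] /=; rewrite ?inE /= => lt_ij ->.
  by exists (j, i).
by exists (j, i); rewrite ?inE.
Qed.

Lemma edge_inj : {in edge_pair &, injective (fun p : 'I_n * 'I_n => [set p.2; p.1])}.
Proof. by move=> p q /andP[lt_p _] /andP[lt_q _]; apply: set2_ltn_inj. Qed.

Lemma card_edges : #|edges h| = edge_count h.
Proof.
rewrite edgesE (card_in_imset edge_inj) -sum1_card /edge_count.
under [RHS]eq_bigr do rewrite -card_between.
by rewrite pair_big_dep.
Qed.

Lemma properE N (f : {ffun 'I_n -> 'I_N}) :
  Defs.proper (edges h) f = [forall p, edge_pair p ==> (f p.1 != f p.2)].
Proof.
rewrite edgesE; apply/forallP/forallP => [prop_f [i j] | prop_f i].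
  apply/implyP => ep; have /forallP/(_ i)/implyP := prop_f j.
  by rewrite eq_sym; apply; apply/imsetP; exists (i, j).
apply/forallP => j; apply/implyP => /imsetP[[a b] ep E].
have ne_ab : f a != f b by apply: (implyP (prop_f (a, b))).
have: a \in [set i; j] by rewrite E !inE eqxx orbT.
have: b \in [set i; j] by rewrite E !inE eqxx.
rewrite !inE => /orP[] /eqP Db /orP[] /eqP Da; rewrite Da Db ?eqxx // in ne_ab.
by rewrite eq_sym.
Qed.

Lemma ascE N (f : {ffun 'I_n -> 'I_N}) :
  asc (edges h) f = #|[pred p | edge_pair p && (f p.1 < f p.2)%N]|.
Proof.
rewrite -(@card_in_imset _ _ (fun p : 'I_n * 'I_n => [set p.2; p.1])); last first.
  by move=> p q /andP[ep _] /andP[eq _]; apply: edge_inj.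
apply: eq_card => e; rewrite inE edgesE; apply/andP/imsetP.
  case=> /imsetP[p ep ->] /existsP[i /existsP[j /and3P[/eqP E lt_ji lt_f]]].
  exists p => //; rewrite inE; apply/andP; split=> //.
  suff -> : p = (j, i) by [].
  by apply: set2_ltn_inj => //; case/andP: ep.
case=> p /andP[ep lt_f] ->; split; first by apply/imsetP; exists p.
apply/existsP; exists p.2; apply/existsP; exists p.1; rewrite eqxx lt_f andbT /=.
by case/andP: ep.
Qed.

Lemma chromatic_weight N (f : {ffun 'I_n -> 'I_N}) :
  fweight (hess_nat h) f = if Defs.proper (edges h) f then 'X^(asc (edges h) f) else 0.
Proof.
have -> : fweight (hess_nat h) f = \prod_(p | edge_pair p) cmp_weight (f p.1) (f p.2).
  rewrite /fweight /coloring_weight pair_big_dep; apply: eq_bigl => p.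
  by rewrite hess_natE.
rewrite properE ascE; case: ifP => [/forallP prop_f | /negbT].
  rewrite -prodr_const.
  rewrite [RHS](eq_bigl (fun p => edge_pair p && (f p.1 < f p.2)%N)) //.
  rewrite [RHS]big_mkcondr; apply: eq_bigr => p ep; rewrite /cmp_weight val_eqE.
  by have /implyP/(_ ep) := prop_f p; case: eqP.
rewrite negb_forall => /existsP[p]; rewrite negb_imply negbK => /andP[ep /eqP fp].
by rewrite (bigD1 p) //= /cmp_weight fp eqxx mul0r.
Qed.

Lemma eval_chromatic N (v : 'I_N -> {poly rat}) :
  (chromatic_qsym (edges h) N).@[v]
  = \sum_(f : {ffun 'I_n -> 'I_N}) fweight (hess_nat h) f * \prod_(i < n) v (f i).
Proof.
rewrite /chromatic_qsym raddf_sum big_mkcond; apply: eq_bigr => f _ /=.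
rewrite chromatic_weight; case: ifP => _; last by rewrite mul0r.
by rewrite mevalZ rmorph_prod; congr (_ * _); apply: eq_bigr => i _; rewrite /= mevalXU.
Qed.

(** Inclusion-exclusion, from expanding the product over colours of 1 minus the indicator that the
    colour is missed; [B] collects the colours where 1 is chosen. *)
Lemma surj_indicator k (f : {ffun 'I_n -> 'I_k}) :
  (surj f)%:R = \sum_(B : {set 'I_k}) (-1) ^+ (k - #|B|) * \prod_(i < n) (f i \in B)%:R
                  :> {poly rat}.
Proof.
have -> : (surj f)%:R
    = \prod_(c < k) (1 - (~~ [exists i, f i == c])%:R) :> {poly rat}.
  case: (boolP (surj f)) => [/forallP sf | ].
    by rewrite big1 // => c _; rewrite sf subr0.
  by rewrite negb_forall => /existsP[c nc]; rewrite (bigD1 c) //= nc subrr mul0r.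
rewrite bigA_distr; apply: eq_bigr => B _.
have -> : (k - #|B| = #|~: B|)%N by rewrite [RHS]cardsCs setCK card_ord.
rewrite (bigID (mem B)) /= big1 ?mul1r => [|c ->] //.
under eq_bigr => c nc do rewrite (negPf nc) -mulN1r.
rewrite big_split /= prodr_const; congr (_ ^+ _ * _); first by apply: eq_card => c; rewrite !inE.
case: (boolP [forall i, f i \in B]) => [/forallP fB | ].
  rewrite !big1 // => [i _ | c nc]; first by rewrite fB.
  case: existsP => // -[i /eqP fi]; by rewrite -fi fB in nc.
rewrite negb_forall => /existsP[i ni]; rewrite [RHS](bigD1 i) //= (negPf ni) mul0r.
by rewrite (bigD1 (f i)) //=; case: existsP => [_ | []]; [rewrite mul0r | exists i].
Qed.

Lemma eval_mesym k (B : {set 'I_k}) r :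
  (mesym k {poly rat} r).@[fun c => (c \in B)%:R] = 'C(#|B|, r)%:R.
Proof.
rewrite -cards_draws -sum1_card natr_sum /mesym raddf_sum /=.
rewrite big_mkcond [RHS]big_mkcond; apply: eq_bigr => S _; rewrite inE andbC.
case: eqP => //= _; rewrite rmorph_prod /=; under eq_bigr do rewrite mevalXU.
case: (boolP (S \subset B)) => [/subsetP SB | /subsetPn[c cS nc]].
  by rewrite big1 // => c /SB ->.
by rewrite (bigD1 c) //= (negPf nc) mul0r.
Qed.

Lemma sum_card_set k (g : nat -> rat) :
  \sum_(B : {set 'I_k}) g #|B| = \sum_(j < k.+1) 'C(k, j)%:R * g j.
Proof.
have le_k (B : {set 'I_k}) : (#|B| < k.+1)%N by rewrite ltnS -[k in (_ <= k)%N]card_ord max_card.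
rewrite (partition_big (fun B => Ordinal (le_k B)) predT) //=; apply: eq_bigr => j _.
rewrite -[k in 'C(k, _)]card_ord -card_draws -sum1_card natr_sum mulr_suml.
by apply: eq_big => [B | B /eqP <-]; rewrite ?inE ?mul1r.
Qed.

(** The alternating sum of [alternating_surj] is computed a second time through the e_la, each of
    which contributes (-1)^n by [sum_fdiff_bin]. *)
Lemma sum_elementary_coef (a : partition_of n -> {poly rat}) :
    (forall N, chromatic_qsym (edges h) N
               = \sum_(la : partition_of n) a la *: elementary_part {poly rat} la N) ->
  \sum_la a la = \prod_(i < n) tint (h i - i).+1.
Proof.
move=> aX; pose Q (la : partition_of n) j : rat := \prod_(i < n) 'C(j, part la i)%:R.
(* By inclusion-exclusion only values at indicators of sets [B] of colours occur. There e_la depends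
   on the size of [B] alone, and grouping the sets by size forms a [k]-th difference. *)
have T k : \sum_(f : {ffun 'I_n -> 'I_k} | surj f) fweight (hess_nat h) f
    = \sum_la a la * (fdiff (Q la) k)%:P.
  rewrite big_mkcond /=.
  transitivity (\sum_(B : {set 'I_k}) (-1) ^+ (k - #|B|)
                  * (chromatic_qsym (edges h) k).@[fun c => (c \in B)%:R]).
    under [RHS]eq_bigr do rewrite eval_chromatic mulr_sumr.
    rewrite exchange_big; apply: eq_bigr => f _.
    under [RHS]eq_bigr do rewrite mulrCA.
    by rewrite -mulr_sumr -surj_indicator; case: (surj f); rewrite (mulr1, mulr0).
  under [LHS]eq_bigr do rewrite aX raddf_sum mulr_sumr.
  rewrite exchange_big; apply: eq_bigr => la _ /=.
  under eq_bigr do rewrite mevalZ mulrCA.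
  rewrite -mulr_sumr; congr (_ * _).
  rewrite /fdiff; under [X in X%:P]eq_bigr do rewrite [_ * 'C(_, _)%:R]mulrC -mulrA.
  rewrite -(sum_card_set k (fun j => (-1) ^+ (k - j) * Q la j)) rmorph_sum.
  apply: eq_bigr => B _; rewrite rmorphM rmorphXn rmorphN rmorph1; congr (_ * _).
  rewrite /elementary_part rmorph_prod /Q rmorph_prod; apply: eq_bigr => i _ /=.
  by rewrite eval_mesym rmorph_nat.
have := alternating_surj (hess_nat_bounds hess_h) (hess_nat_mono hess_h).
under eq_bigr do rewrite T mulr_sumr.
rewrite exchange_big /=.
under eq_bigr => la _.
  under eq_bigr do rewrite mulrCA -[(-1) ^+ _](rmorph_sign polyC) -rmorphM.
  rewrite -mulr_sumr -rmorph_sum sum_fdiff_bin rmorph_sign.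
  over.
rewrite -mulr_suml mulrC => /(mulrI (unitrX _ (unitrN1 _))) ->.
by apply: eq_bigr => i _; rewrite hess_natE.
Qed.

End ChromaticEvaluation.

(** * Truncation to one variable *)

Section OneVariable.
Variables (n : nat) (R : comNzRingType).

Definition eval1 (p : {mpoly R[1]}) : R := p.@[fun=> 1].

(** With a single entry available, columns have at most one cell; the one-row shape has exactly one
    filling. *)
Lemma eval1_schur (la : partition_of n) :
  eval1 (schur R la 1) = (la == one_row n)%:R.
Proof.
have partE i : part (one_row n) i = if i == 0%N :> nat then n else 0%N.
  by rewrite /part /= ffunE; case: eqP.
have -> : eval1 (schur R la 1) = (\sum_(T : {ffun cell la -> 'I_1} | semistandard T) 1)%:R.
  rewrite /eval1 /schur raddf_sum natr_sum; apply: eq_bigr => T _ /=.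
  by rewrite rmorph_prod big1 // => c _; rewrite /= mevalXU.
congr _%:R; case: eqP => [-> | ne_la].
  rewrite (eq_bigl predT) => [|T].
    by rewrite sum1_card card_ffun card_ord exp1n.
  apply/forallP => -[[i j] ij]; apply/forallP => -[[i' j'] i'j'] /=.
  have T0 x : T x = ord0 by apply: ord1.
  rewrite !T0 leqnn implybT /=.
  move: ij i'j'; rewrite /= !partE; case: eqP => // -> _; case: eqP => // -> _.
  by rewrite ltnn andbF.
have [i i_gt0 la_i] : exists2 i : 'I_n, (0 < i)%N & (0 < part la i)%N.
  apply/exists_inP; apply: contra_notT ne_la => /exists_inPn la0.
  have part0 (i : 'I_n) : (0 < i)%N -> val la i = ord0.
    by move/la0; rewrite lt0n negbK => /eqP lai; apply: val_inj.
  apply/val_inj/ffunP => i; rewrite /= ffunE; case: eqP => [i0 | /eqP]; last first.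
    by rewrite -lt0n => /part0.
  apply: val_inj => /=; case/andP: (valP la) => _ /eqP.
  rewrite (bigD1 i) //= big1 ?addn0 // => j ne_ji; rewrite part0 //.
  by rewrite lt0n -i0 val_eqE.
have n_gt0 : (0 < n)%N by apply: leq_ltn_trans (ltn_ord i).
pose o := Ordinal n_gt0.
have la_o : (0 < part la o)%N.
  apply: leq_trans la_i _; case/andP: (valP la) => /forallP/(_ o)/forallP/(_ i).
  by move/implyP => + _; apply.
pose c : cell la := exist _ (o, o) la_o; pose d : cell la := exist _ (i, o) la_i.
rewrite big_pred0 // => T; apply/negP => /forallP/(_ c)/forallP/(_ d) /andP[_].
move/implyP/(_ (introT andP (conj (eqxx o) i_gt0))).
by rewrite (ord1 (T c)) (ord1 (T d)) ltnn.
Qed.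

Lemma eval1_complete k : eval1 (complete R k 1) = 1.
Proof.
rewrite /eval1 /complete raddf_sum /=.
have m_lt : (mdeg (U_(ord0 : 'I_1) *+ k)%MM < k.+1)%N.
  by rewrite mdegMn mdeg1 mul1n.
rewrite (big_pred1 (BMultinom m_lt)).
  by rewrite mevalX big1 // => i _; rewrite expr1n.
move=> m; rewrite /= -val_eqE /=; apply/eqP/eqP => [dm | ->]; last by rewrite mdegMn mdeg1 mul1n.
apply/mnmP => i; rewrite mulmnE mnm1E [i]ord1 eqxx mul1n.
by move: dm; rewrite mdegE big_ord_recl big_ord0 addn0.
Qed.

Lemma eval1_complete_part (la : partition_of n) : eval1 (complete_part R la 1) = 1.
Proof.
rewrite /eval1 /complete_part rmorph_prod big1 // => i _; exact: eval1_complete.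
Qed.

Lemma eval1_schur_expansion F (c : partition_of n -> R) :
  schur_expansion F c -> eval1 (F 1%N) = c (one_row n).
Proof.
move=> ->; rewrite /eval1 raddf_sum (bigD1 (one_row n)) //= big1 ?addr0 => [|la /negPf ne_la].
  by rewrite mevalZ [_.@[_]]eval1_schur eqxx mulr1.
by rewrite mevalZ [_.@[_]]eval1_schur ne_la mulr0.
Qed.

End OneVariable.

(** Every power sum becomes 1; for a character [chi] the multiplicity of the trivial representation
    remains. *)
Lemma eval1_Frobenius n (chi : 'S_n -> rat) :
  eval1 (Frobenius_ch chi 1) = (n`!%:R)^-1 * \sum_w chi w.
Proof.
rewrite /eval1 /Frobenius_ch mevalZ raddf_sum; congr (_ * _).
apply: eq_bigr => w _; rewrite /= mevalZ rmorph_prod big1 ?mulr1 // => C _.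
by rewrite /psum /= big_ord_recl big_ord0 addr0 rmorphXn /= mevalXU expr1n.
Qed.

Lemma eval1_map_polyC (p : {mpoly rat[1]}) :
  eval1 (map_mpoly (@polyC rat) p) = (eval1 p)%:P.
Proof.
elim/mpoly_ring_ind: p => [a | i | p q Ep Eq | p q Ep Eq].
- by rewrite map_mpolyC /eval1 !mevalC.
- by rewrite map_mpolyX /eval1 !mevalXU.
- by rewrite /eval1 rmorphD /= !mevalD polyCD -Ep -Eq.
by rewrite /eval1 rmorphM /= !mevalM polyCM -Ep -Eq.
Qed.

Lemma eval1_graded_ch n d (chi : nat -> 'S_n -> rat) :
  eval1 (graded_ch d chi 1)
  = \sum_(j < d.+1) 'X^j * ((n`!%:R)^-1 * \sum_w chi j w)%:P.
Proof.
rewrite /eval1 /graded_ch raddf_sum; apply: eq_bigr => j _.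
by rewrite /= mevalZ [_.@[_]]eval1_map_polyC eval1_Frobenius.
Qed.

Theorem mainTheorem4 (n : nat) (h : 'I_n -> 'I_n) (hess_h : Hessenberg h)
  (omegaX : bseries {poly rat})
  (omegaX_spec : is_omega n (chromatic_qsym (edges h)) omegaX)
  (chi : nat -> 'S_n -> rat)
  (chi_spec : forall j : nat, H_character h j (chi j))
  (c d : partition_of n -> {poly rat})
  (c_spec : schur_expansion omegaX c)
  (d_spec : schur_expansion (graded_ch #|edges h| chi) d) :
  c (one_row n) = d (one_row n).
Proof.
(* The images h_la of the e_la all become 1 in one variable, leaving the sum of the coefficients. *)
have -> : c (one_row n) = \prod_(i < n) tint (h i - i).+1.
  case: omegaX_spec => a [aX aomega]; rewrite -(eval1_schur_expansion c_spec) aomega.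
  rewrite -(sum_elementary_coef hess_h aX) /eval1 raddf_sum; apply: eq_bigr => la _.
  by rewrite /= mevalZ [_.@[_]]eval1_complete_part mulr1.
rewrite -(eval1_schur_expansion d_spec) eval1_graded_ch card_edges.
under [RHS]eq_bigr => j _ do rewrite (H_character_average hess_h (chi_spec j)) mulrC mul_polyC.
rewrite -(poly_def _ (fun j => (size (bas n (hess_nat h) 0 n j))%:R)).
have prodE : \prod_(i < n) tint (h i - i).+1
    = \prod_(0 <= k < 0 + n) tint (hess_nat h k - k).+1.
  by rewrite add0n big_mkord; apply: eq_bigr => i _; rewrite hess_natE.
apply/polyP => j; rewrite coef_poly prodE -(size_bas n).
(* Beyond the number of edges the truncated sum has coefficient 0, and the basis has no element
   there. *)
case: ltnP => // lt_j; have [_ ->] := bas_top n (hess_nat h) 0 n => //.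
by rewrite basdeg_edge_count.
Qed.
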